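(* Let $1\leqslant p<2$ and $1\leqslant q\leqslant p$, and let $\{\boldsymbol{y}_{(k)}\}_{k\in\mathbb{N}}$ be an iteration sequence generated by the algorithm $q$P$p$NWAWS (defined in the context). (1) If some iterate $\boldsymbol{y}_{(k)}$ is a minimum point of $C_{p,q}$, this is recognized, and the algorithm stopped, by the following characterization: if $\boldsymbol{y}_{(k)}\notin\mathcal{S}_p$, then $\boldsymbol{y}_{(k)}$ is a minimum point of $C_{p,q}$ if and only if $\mathbf{T}_{p,q}(\boldsymbol{y}_{(k)})=\boldsymbol{y}_{(k)}$; if $\boldsymbol{y}_{(k)}\in\mathcal{S}_p$, then $\boldsymbol{y}_{(k)}$ is a minimum point of $C_{p,q}$ if and only if $\mathbf{0}_d\in\partial C_{p,q}(\boldsymbol{y}_{(k)})$, where $\partial C_{p,q}(\boldsymbol{y}_{(k)})$ is given by the explicit formula in the context. (2) Otherwise (no iterate is a minimum point), the sequence of cost function values $\{C_{p,q}(\boldsymbol{y}_{(k)})\}_{k\in\mathbb{N}}$ converges. (3) In the situation of (2), assume in addition $1<p<2$. If $\boldsymbol{y}_{(k)}\in\mathcal{S}_p$ for only finitely many $k$, then $\{\boldsymbol{y}_{(k)}\}_{k\in\mathbb{N}}$ also converges. (4) In the situation of (2), assume in addition $1<p<2$. If $\{\boldsymbol{y}_{(k)}\}_{k\in\mathbb{N}}$ has a cluster point not in $\mathcal{S}_p$, then this cluster point is exactly the minimum point $\boldsymbol{x}_*$ of $C_{p,q}$, and the entire sequence $\{\boldsymbol{y}_{(k)}\}_{k\in\mathbb{N}}$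 converges to $\boldsymbol{x}_*$.
   Context: Data: $\boldsymbol{x}_1,\dots,\boldsymbol{x}_m\in\mathbb{R}^d$ are fixed data points, distinct and non-collinear, with weights $\eta_1,\dots,\eta_m>0$. Superscript $(t)$ denotes the $t$-th coordinate, $1\leqslant t\leqslant d$, and $\|\cdot\|_p$ is the $\ell_p$ norm on $\mathbb{R}^d$. Cost function: $C_{p,q}(\boldsymbol{y}):=\sum_{i=1}^m \eta_i^q\|\boldsymbol{y}-\boldsymbol{x}_i\|_p^q$. A minimum point means a global minimizer of $C_{p,q}$ over $\mathbb{R}^d$; for $1<p<2$ it is unique and denoted $\boldsymbol{x}_*$. Singular set: $\mathcal{S}_p:=\{\boldsymbol{y}\in\mathbb{R}^d : \exists i\in\{1,\dots,m\},\ \exists t\in\{1,\dots,d\}\text{ such that } y^{(t)}=x_i^{(t)}\}$. For $\boldsymbol{y}\in\mathbb{R}^d$, $V_t(\boldsymbol{y}):=\{i\in\{1,\dots,m\} : y^{(t)}=x_i^{(t)}\}$. Operator at nonsingular points: for $\boldsymbol{y}\notin\mathcal{S}_p$, $$\big(\mathbf{T}_{p,q}(\boldsymbol{y})\big)^{(t)}:=\frac{\sum_{i=1}^m \eta_i^q\|\boldsymbol{y}-\boldsymbol{x}_i\|_p^{q-p}|y^{(t)}-x_i^{(t)}|^{p-2}x_i^{(t)}}{\sum_{i=1}^m \eta_i^q\|\boldsymbol{y}-\boldsymbol{x}_i\|_p^{q-p}|y^{(t)}-x_i^{(t)}|^{p-2}},\qquad 1\leqslant t\leqslant d.$$ De-singularity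 subgradient: $\nabla D_{p,q}(\boldsymbol{y})\in\mathbb{R}^d$ is the vector with $$\big(\nabla D_{p,q}(\boldsymbol{y})\big)^{(t)}:=\sum_{i\notin V_t(\boldsymbol{y})} q\,\eta_i^q\|\boldsymbol{y}-\boldsymbol{x}_i\|_p^{q-p}|y^{(t)}-x_i^{(t)}|^{p-2}(y^{(t)}-x_i^{(t)}).$$ Subgradients: $\partial C_{p,q}(\boldsymbol{y})$ is the set of $\boldsymbol{v}\in\mathbb{R}^d$ with $C_{p,q}(\boldsymbol{z})-C_{p,q}(\boldsymbol{y})\geqslant\boldsymbol{v}^\top(\boldsymbol{z}-\boldsymbol{y})$ for all $\boldsymbol{z}$. The explicit formula for $\boldsymbol{y}\in\mathcal{S}_p$ is: $\{\nabla D_{1,1}(\boldsymbol{y})+\boldsymbol{u}: |u^{(t)}|\leqslant a^{(t)}\ \forall t\}$ with $a^{(t)}=\sum_{i\in V_t(\boldsymbol{y})}\eta_i$ if $p=q=1$; $\{\nabla D_{p,1}(\boldsymbol{y})\}$ if $q=1$, $1<p<2$, $\boldsymbol{y}\in\mathcal{S}_p\setminus\{\boldsymbol{x}_i\}_{i=1}^m$; $\{\nabla D_{p,1}(\boldsymbol{x}_l)+\eta_l\boldsymbol{b}:\|\boldsymbol{b}\|_r\leqslant1\}$ with $\frac1r+\frac1p=1$ if $q=1$, $1<p<2$, $\boldsymbol{y}=\boldsymbol{x}_l$; $\{\nabla D_{p,q}(\boldsymbol{y})\}$ if $1<q\leqslant p$, $1<p<2$. Direction at singular points: $\mathscr{D}_{p,q}(\boldsymbol{y}):=(\nabla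 D_{p,1}(\boldsymbol{x}_l))^{r/p}$ (element-wise signed power $w\mapsto\operatorname{sign}(w)|w|^{r/p}$, $\frac1r+\frac1p=1$) if $q=1$, $1<p<2$, $\boldsymbol{y}=\boldsymbol{x}_l$ for some $l$; and $\mathscr{D}_{p,q}(\boldsymbol{y}):=\nabla D_{p,q}(\boldsymbol{y})$ otherwise. Algorithm $q$P$p$NWAWS: start from any $\boldsymbol{y}_{(0)}\in\mathbb{R}^d$. If $\boldsymbol{y}_{(k)}$ is a minimum point of $C_{p,q}$, stop. Otherwise set $\boldsymbol{y}_{(k+1)}:=\mathbf{T}_{p,q}(\boldsymbol{y}_{(k)})$ if $\boldsymbol{y}_{(k)}\notin\mathcal{S}_p$, and $\boldsymbol{y}_{(k+1)}:=\boldsymbol{y}_{(k)}-\lambda_*\mathscr{D}_{p,q}(\boldsymbol{y}_{(k)})$ if $\boldsymbol{y}_{(k)}\in\mathcal{S}_p$, where the step size $\lambda_*>0$ (depending on $k$) is obtained by line search: with fixed $0<\rho<1$, $\lambda_*$ is the first of $\lambda_0=\|\mathscr{D}_{p,q}(\boldsymbol{y}_{(k)})\|_p$, $\lambda_{w+1}=\rho\lambda_w$, for which $C_{p,q}(\boldsymbol{y}_{(k)}-\lambda_*\mathscr{D}_{p,q}(\boldsymbol{y}_{(k)}))<C_{p,q}(\boldsymbol{y}_{(k)})$. (Numerical tolerance stopping is not considered.) *)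

(* Defs.v *)
From HB Require Import structures.
From mathcomp Require Import all_boot all_order all_algebra.
From mathcomp Require Import all_classical all_reals all_analysis.

Set Implicit Arguments.
Unset Strict Implicit.
Unset Printing Implicit Defensive.

Import Order.TTheory GRing.Theory Num.Theory.
Import numFieldNormedType.Exports.

Local Open Scope classical_set_scope.
Local Open Scope ring_scope.

(* With powR, 0 `^ a = 0 for a != 0 (even a < 0) and 0 `^ 0 = 1.  In the
   parameter ranges of interest (1 <= q <= p < 2) a base that may vanish only
   carries a positive exponent, except in T_op at singular points, where T_op
   is not meant to be used. *)

Definition lpnorm (R : realType) (d : nat) (p : R) (v : 'rV[R]_d) : R :=
  (\sum_(t < d) `|v 0 t| `^ p) `^ p^-1.

(* The r with 1/r + 1/p = 1, for p > 1. *)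
Definition conj_exponent (R : realType) (p : R) : R := (1 - p^-1)^-1.

(* The line is degenerate when v = 0, so single points are collinear too. *)
Definition collinear (R : realType) (d m : nat) (x : 'I_m -> 'rV[R]_d) : Prop :=
  exists a v : 'rV[R]_d, forall i, exists s : R, x i = a + s *: v.

Definition cost (R : realType) (d m : nat) (x : 'I_m -> 'rV[R]_d)
    (eta : 'I_m -> R) (p q : R) (y : 'rV[R]_d) : R :=
  \sum_(i < m) eta i `^ q * lpnorm p (y - x i) `^ q.

Definition is_minimum_point (R : realType) (d : nat) (f : 'rV[R]_d -> R)
    (y : 'rV[R]_d) : Prop :=
  forall z, f y <= f z.

Definition singular_set (R : realType) (d m : nat) (x : 'I_m -> 'rV[R]_d) :
    set 'rV[R]_d :=
  [set y : 'rV[R]_d | exists (i : 'I_m) (t : 'I_d), y 0 t = x i 0 t].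

Definition V (R : realType) (d m : nat) (x : 'I_m -> 'rV[R]_d)
    (y : 'rV[R]_d) (t : 'I_d) : {pred 'I_m} :=
  [pred i | y 0 t == x i 0 t].

Definition T_op (R : realType) (d m : nat) (x : 'I_m -> 'rV[R]_d)
    (eta : 'I_m -> R) (p q : R) (y : 'rV[R]_d) : 'rV[R]_d :=
  \row_(t < d)
    ((\sum_(i < m) eta i `^ q * lpnorm p (y - x i) `^ (q - p)
                   * `|y 0 t - x i 0 t| `^ (p - 2) * x i 0 t)
     / (\sum_(i < m) eta i `^ q * lpnorm p (y - x i) `^ (q - p)
                     * `|y 0 t - x i 0 t| `^ (p - 2))).

Definition gradD (R : realType) (d m : nat) (x : 'I_m -> 'rV[R]_d)
    (eta : 'I_m -> R) (p q : R) (y : 'rV[R]_d) : 'rV[R]_d :=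
  \row_(t < d)
    \sum_(i < m | i \notin V x y t)
      q * eta i `^ q * lpnorm p (y - x i) `^ (q - p)
      * `|y 0 t - x i 0 t| `^ (p - 2) * (y 0 t - x i 0 t).

Definition subdifferential (R : realType) (d : nat) (f : 'rV[R]_d -> R)
    (y : 'rV[R]_d) : set 'rV[R]_d :=
  [set v : 'rV[R]_d | forall z : 'rV[R]_d, \sum_(t < d) v 0 t * (z 0 t - y 0 t) <= f z - f y].

(* Meant for y in the singular set, 1 <= p < 2 and 1 <= q <= p: the four
   disjuncts are then mutually exclusive (up to the choice of l) and exhaustive. *)
Definition subdifferential_formula (R : realType) (d m : nat)
    (x : 'I_m -> 'rV[R]_d) (eta : 'I_m -> R) (p q : R) (y : 'rV[R]_d) :
    set 'rV[R]_d :=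
  [set v : 'rV[R]_d |
    [\/ [/\ p = 1, q = 1 &
          exists2 u : 'rV[R]_d,
            forall t, `|u 0 t| <= \sum_(i < m | i \in V x y t) eta i &
            v = gradD x eta 1 1 y + u],
        [/\ q = 1, 1 < p < 2, forall i, y <> x i & v = gradD x eta p 1 y],
        [/\ q = 1, 1 < p < 2 &
          exists2 l, y = x l &
          exists2 b : 'rV[R]_d, lpnorm (conj_exponent p) b <= 1 &
            v = gradD x eta p 1 (x l) + eta l *: b] |
        [/\ 1 < q <= p, 1 < p < 2 & v = gradD x eta p q y]]].

Definition signed_powR (R : realType) (w a : R) : R := Num.sg w * `|w| `^ a.

Definition direction (R : realType) (d m : nat) (x : 'I_m -> 'rV[R]_d)
    (eta : 'I_m -> R) (p q : R) (y : 'rV[R]_d) : 'rV[R]_d :=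
  if [&& q == 1, 1 < p < 2 & [exists l, y == x l]]
  then map_mx (fun w => signed_powR w (conj_exponent p / p)) (gradD x eta p 1 y)
  else gradD x eta p q y.

Definition line_search_point (R : realType) (d m : nat) (x : 'I_m -> 'rV[R]_d)
    (eta : 'I_m -> R) (p q rho : R) (y : 'rV[R]_d) (w : nat) : 'rV[R]_d :=
  let D := direction x eta p q y in y - (rho ^+ w * lpnorm p D) *: D.

Definition line_search_step (R : realType) (d m : nat) (x : 'I_m -> 'rV[R]_d)
    (eta : 'I_m -> R) (p q rho : R) (y y' : 'rV[R]_d) : Prop :=
  let C := cost x eta p q in
  let trial := line_search_point x eta p q rho y in
  exists w : nat,
    [/\ C (trial w) < C y,
        forall v : nat, (v < w)%N -> ~~ (C (trial v) < C y) &
        y' = trial w].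

(* A run of the algorithm that stops at a minimum point is represented by the
   infinite sequence that stays at that point forever. *)
Definition qPpNWAWS (R : realType) (d m : nat) (x : 'I_m -> 'rV[R]_d)
    (eta : 'I_m -> R) (p q rho : R) (y : nat -> 'rV[R]_d) : Prop :=
  forall k : nat,
    [/\ is_minimum_point (cost x eta p q) (y k) -> y k.+1 = y k,
        ~ is_minimum_point (cost x eta p q) (y k) -> ~ singular_set x (y k) ->
          y k.+1 = T_op x eta p q (y k) &
        ~ is_minimum_point (cost x eta p q) (y k) -> singular_set x (y k) ->
          line_search_step x eta p q rho (y k) (y k.+1)].

(* Main.v *)
Require Import Defs.
From HB Require Import structures.
From mathcomp Require Import all_boot all_order all_algebra.
From mathcomp Require Import all_classical all_reals all_analysis.
From mathcomp Require Import ring lra.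
Set Implicit Arguments.
Unset Strict Implicit.
Unset Printing Implicit Defensive.
Import Order.TTheory GRing.Theory Num.Theory.
Import numFieldNormedType.Exports.
Local Open Scope classical_set_scope.
Local Open Scope ring_scope.

(** Write N for the p-norm. Everything rests on one scalar fact, the tangent
    inequality a^s + s a^(s-1) (b - a) <= b^s for s >= 1, and on its concave
    counterpart for 0 < s <= 1 (powR_tangent, powR_tangent_concave).

    Summed over coordinates, the convex tangent gives Hoelder's inequality with
    its equality case, hence a tangent inequality for N^q (lp_tangent) in
    which, for p > 1 and u <> 0, equality forces w to be a multiple of u
    (lp_tangent_eq). Summed over the data points, it says that gradD y is
    always a subgradient of the cost. For p > 1, equality between two distinct
    points y and z would put every data point on the line through y and z, so
    for non-collinear data the inequality is strict (cost_tangent_strict).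

    Conversely, a subgradient v at y satisfies <v, h> <= the right derivative of
    the cost at y along h. The tangent inequality at y + s h bounds the
    difference quotient by the slope at y + s h, and the limit s -> 0+ only
    asks for continuity of that slope (subgradient_slope_le). This yields
    v = gradD y where the cost is smooth (subgradient_unique), a ball of the
    dual norm at a data point when q = 1 (data_point_subgradientP), and a box
    when p = q = 1 (cost11_subgradientP).

    The concave tangents, for the exponents q/p and p/2, majorize the cost at a
    nonsingular y by a separable quadratic that touches it at y and whose
    minimizer is T y. So T decreases the cost by at least a multiple of
    |T y - y|^2, uniformly on sublevel sets (cost_descent, level_descent). The
    line search decreases it by definition, so the cost values converge and the
    steps at nonsingular iterates tend to 0.

    Consequently, at a cluster point c near which the iterates are eventually
    nonsingular, every coordinate t in which c differs from all data points
    satisfies (T c)_t = c_t, that is, (gradD c)_t = 0 (cluster_T_op_fixed). If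
    c is nonsingular, then gradD c = 0 and c is the unique minimizer; every
    other cluster point has the same cost, so the bounded sequence converges
    to c. If only finitely many iterates are singular, record for each
    coordinate of a cluster point whether it agrees with a data point, and with
    which one. Two cluster points with the same record have gradients that
    vanish on all coordinates where the points differ, hence are equal by
    strict convexity, so there are at most (m + 1)^d cluster points. But steps
    tending to 0 make the cluster values of each coordinate an interval, so
    there is only one cluster point, and the bounded sequence converges
    (cluster_coord_not_lt, finitely_singular_cvg). *)

(** * Real powers and their tangents *)

Section ScalarPowers.
Variable R : realType.
Implicit Types a b e p s w z : R.

(** Young's inequality for b and a^(p-1), multiplied by p. *)
Lemma powR_tangent p a b : 1 <= p -> 0 <= a -> 0 <= b ->
  a `^ p + p * a `^ (p - 1) * (b - a) <= b `^ p.
Proof.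
move=> p1 a0 b0; have p0 : 0 < p by lra.
have [->|pn1] := eqVneq p 1.
  by rewrite subrr powRr0 !powRr1 // mulr1; lra.
have pgt1 : 0 < p - 1 by rewrite subr_gt0 lt_def pn1 p1.
have pV : p * p^-1 = 1 by rewrite divff // gt_eqF.
have pV1 : 0 < 1 - p^-1.
  by rewrite subr_gt0 invf_lt1 // lt_def pn1.
have pV10 : 0 < (1 - p^-1)^-1 by rewrite invr_gt0.
have pV2 : p^-1 + (1 - p^-1)^-1^-1 = 1 by rewrite invrK; lra.
have := conjugate_powR b0 (powR_ge0 a (p - 1)) p0 pV10 pV2.
rewrite invrK -powRrM.
have -> : (p - 1) * (1 - p^-1)^-1 = p.
  have -> : p - 1 = p * (1 - p^-1) by rewrite mulrBr pV mulr1.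
  by rewrite mulfK // gt_eqF.
have e1 : a * a `^ (p - 1) = a `^ p by exact: mulr_powRB1.
move=> /(ler_wpM2l (ltW p0)).
have -> : p * (b `^ p / p + a `^ p * (1 - p^-1)) =
  (p * p^-1) * b `^ p + (p - p * p^-1) * a `^ p by ring.
rewrite pV -e1; lra.
Qed.

(** The convex tangent inequality with exponent 1/s at a^s and b^s, solved for
    b^s. *)
Lemma powR_tangent_concave s a b : 0 < s <= 1 -> 0 < a -> 0 <= b ->
  b `^ s <= a `^ s + s * a `^ (s - 1) * (b - a).
Proof.
move=> /andP[s0 s1] a0 b0.
have V1 : 1 <= s^-1 by rewrite invf_ge1.
have := powR_tangent V1 (powR_ge0 a s) (powR_ge0 b s).
rewrite -!powRrM divff ?gt_eqF // (powRr1 (ltW a0)) (powRr1 b0).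
rewrite (_ : s * (s^-1 - 1) = 1 - s); last by rewrite mulrBr mulr1 divff ?gt_eqF.
rewrite -(ler_pM2l s0) mulrDr !mulrA divff ?gt_eqF // mul1r => h.
have ap : 0 < a `^ (s - 1) by exact: powR_gt0.
have e1 : a `^ (1 - s) * a `^ (s - 1) = 1.
  rewrite -powRD; last by rewrite (gt_eqF a0) implybT.
  by rewrite (_ : 1 - s + (s - 1) = 0) ?powRr0 //; lra.
move: h; rewrite -(ler_pM2r ap) => h.
have e2 : (s * a + a `^ (1 - s) * (b `^ s - a `^ s)) * a `^ (s - 1) =
  s * a * a `^ (s - 1) + (a `^ (1 - s) * a `^ (s - 1)) * (b `^ s - a `^ s).
  by ring.
rewrite e2 e1 in h; lra.
Qed.

Lemma powR_anti a b e : 0 < a -> a <= b -> e <= 0 -> b `^ e <= a `^ e.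
Proof.
move=> a0 ab e0; rewrite -(opprK e) (powRN b) (powRN a).
rewrite lef_pV2 ?posrE ?powR_gt0 //; last exact: lt_le_trans ab.
by rewrite ge0_ler_powR ?oppr_ge0 // nnegrE ltW // (lt_le_trans a0).
Qed.

(** The derivative of |w|^p / p; the factor w makes the value 0 at w = 0 whatever
    the convention for powers of 0. *)
Definition dpow p w := `|w| `^ (p - 2) * w.

Lemma dpow0 p : dpow p 0 = 0.
Proof. by rewrite /dpow mulr0. Qed.

Lemma powR_subr p a e : a != 0 -> a `^ p * a `^ e = a `^ (p + e).
Proof. by move=> a0; rewrite powRD // a0 implybT. Qed.

Lemma normr_dpow p w : w != 0 -> `|dpow p w| = `|w| `^ (p - 1).
Proof.
move=> w0; rewrite normrM ger0_norm ?powR_ge0 //.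
rewrite -{2}(powRr1 (normr_ge0 w)) powR_subr ?normr_eq0 //.
by congr powR; lra.
Qed.

Lemma dpow_mul p w : 0 < p -> dpow p w * w = `|w| `^ p.
Proof.
move=> p0; have [->|w0] := eqVneq w 0.
  by rewrite mulr0 normr0 powR0 // gt_eqF.
rewrite /dpow -mulrA -expr2 -real_normK ?num_real //.
rewrite -(@powR_mulrn _ _ 2) // powR_subr ?normr_eq0 //.
by congr powR; lra.
Qed.

Lemma dpow_mul_le p w z : dpow p w * z <= `|w| `^ (p - 1) * `|z|.
Proof.
have [->|w0] := eqVneq w 0.
  by rewrite dpow0 mul0r mulr_ge0 ?powR_ge0.
by rewrite -normr_dpow // -normrM ler_norm.
Qed.

Lemma dpowE p w : dpow p w = Num.sg w * `|w| `^ (p - 1).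
Proof.
have [->|w0] := eqVneq w 0; first by rewrite dpow0 sgr0 mul0r.
rewrite -normr_dpow // normrM ger0_norm ?powR_ge0 // /dpow mulrCA.
by rewrite -numEsg mulrC.
Qed.

Lemma normr_tangent p a b : 1 <= p ->
  `|a| `^ p + p * dpow p a * (b - a) <= `|b| `^ p.
Proof.
move=> p1; have p0 : 0 < p by lra.
have := powR_tangent p1 (normr_ge0 a) (normr_ge0 b).
have h := dpow_mul_le p a b.
have e1 := dpow_mul a p0.
have e2 : `|a| * `|a| `^ (p - 1) = `|a| `^ p by exact: mulr_powRB1.
apply: le_trans; rewrite lerD2l -!(mulrA p) ler_pM2l // !mulrBr e1; lra.
Qed.

Lemma dpow_lt p a b : 1 < p -> a < b -> dpow p a < dpow p b.
Proof.
move=> p1 ab; rewrite !dpowE; have p0 : 0 < p - 1 by lra.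
have pos z : 0 < z -> 0 < `|z| `^ (p - 1).
  by move=> z0; rewrite powR_gt0 // normr_gt0 gt_eqF.
have pos' z : z < 0 -> 0 < `|z| `^ (p - 1).
  by move=> z0; rewrite powR_gt0 // normr_gt0 lt_eqF.
case: (ltgtP b 0) => [b0|b0|b0].
- have a0 : a < 0 by lra.
  rewrite !ltr0_sg // !mulN1r ltrN2 gt0_ltr_powR // ?nnegrE // !ltr0_norm //.
  lra.
- rewrite (gtr0_sg b0) mul1r; case: (ltgtP a 0) => [a0|a0|->].
  + rewrite ltr0_sg // mulN1r; have := pos _ b0; have := pos' _ a0; lra.
  + rewrite (gtr0_sg a0) mul1r gt0_ltr_powR // ?nnegrE // !gtr0_norm //.
  + by rewrite sgr0 mul0r pos.
- move: ab; rewrite b0 => a0; rewrite sgr0 mul0r ltr0_sg // mulN1r.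
  have := pos' _ a0; lra.
Qed.

(** If the tangent at a met |.|^p again at b, then comparing with the tangent at
    the midpoint would contradict the strict monotonicity of the derivative. *)
Lemma normr_tangent_eq p a b : 1 < p ->
  `|b| `^ p = `|a| `^ p + p * dpow p a * (b - a) -> a = b.
Proof.
move=> p1 eq_ab; apply: contrapT => /eqP nab; have p0 : 0 < p by lra.
set c := (a + b) / 2.
have h1 := normr_tangent a c (ltW p1).
have h2 := normr_tangent c b (ltW p1).
have h3 : p * dpow p c * (b - c) <= p * dpow p a * (b - c) by lra.
case: (ltgtP a b) nab => // ab _.
- have := dpow_lt p1 (_ : a < c); rewrite /c => /(_ ltac:(lra)).
  move: h3; rewrite -!(mulrA p) ler_pM2l // ler_pM2r /c; lra.
- have := dpow_lt p1 (_ : c < a); rewrite /c => /(_ ltac:(lra)).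
  move: h3; rewrite -!(mulrA p) ler_pM2l // ler_nM2r /c; lra.
Qed.

End ScalarPowers.

(** * The p-norm: gradient, equality case, majorant and dual ball *)

(** A sealed copy of lpnorm, so that comparing the norms of two vectors never
    unfolds real powers. *)
HB.lock Definition lp (R : realType) (d : nat) (p : R) (u : 'rV[R]_d) : R :=
  lpnorm p u.

Section LpNorm.
Variables (R : realType) (d : nat).
Implicit Types (p q s : R) (u v w b : 'rV[R]_d).

Lemma lpE p u : lp p u = (\sum_(t < d) `|u 0 t| `^ p) `^ p^-1.
Proof. by rewrite lp.unlock. Qed.

Lemma lp_ge0 p u : 0 <= lp p u.
Proof. by rewrite lpE; exact: powR_ge0. Qed.

Lemma sum_powR_ge0 p u : 0 <= \sum_(t < d) `|u 0 t| `^ p.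
Proof. by apply: sumr_ge0 => t _; exact: powR_ge0. Qed.

Lemma lp_powR p u : 0 < p -> lp p u `^ p = \sum_(t < d) `|u 0 t| `^ p.
Proof.
by move=> p0; rewrite lpE -powRrM mulVf ?gt_eqF // powRr1 ?sum_powR_ge0.
Qed.

Lemma lp_coord p u t : 0 < p -> `|u 0 t| <= lp p u.
Proof.
move=> p0; rewrite leNgt; apply/negP => lt_ut.
have := gt0_ltr_powR p0 (lp_ge0 p u) (normr_ge0 (u 0 t)) lt_ut.
rewrite lp_powR // (bigD1 t) //= ltNge lerDl.
by rewrite sumr_ge0 // => i _; exact: powR_ge0.
Qed.

Lemma lp0 p : 0 < p -> lp p (0 : 'rV[R]_d) = 0.
Proof.
move=> p0; rewrite !lpE big1 => [|t _]; last by rewrite mxE normr0 powR0 ?gt_eqF.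
by rewrite powR0 // invr_eq0 gt_eqF.
Qed.

Lemma lp_eq0 p u : 0 < p -> (lp p u == 0) = (u == 0).
Proof.
move=> p0; apply/eqP/eqP => [u0|->]; last exact: lp0.
apply/rowP => t; rewrite mxE; apply/eqP; rewrite -normr_eq0 eq_le normr_ge0 andbT.
by rewrite -u0 lp_coord.
Qed.

Lemma lp_gt0 p u : 0 < p -> (0 < lp p u) = (u != 0).
Proof. by move=> p0; rewrite lt_def lp_ge0 andbT lp_eq0. Qed.

Lemma lpZ p s u : 0 < p -> lp p (s *: u) = `|s| * lp p u.
Proof.
move=> p0; rewrite !lpE.
under eq_bigr => t _ do rewrite mxE normrM powRM //.
rewrite -mulr_sumr powRM ?powR_ge0 ?sum_powR_ge0 //.
by rewrite -powRrM divff ?gt_eqF // powRr1.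
Qed.

Lemma sum_dpow_self p u : 0 < p ->
  \sum_(t < d) dpow p (u 0 t) * u 0 t = lp p u `^ p.
Proof.
by move=> p0; rewrite lp_powR //; apply: eq_bigr => t _; rewrite dpow_mul.
Qed.

Lemma sum_normr_tangent p u w : 1 <= p ->
  p * \sum_(t < d) dpow p (u 0 t) * w 0 t <=
  lp p w `^ p + (p - 1) * lp p u `^ p.
Proof.
move=> p1; have p0 : 0 < p by lra.
have : \sum_(t < d) (`|u 0 t| `^ p + p * (dpow p (u 0 t) * w 0 t)
    - p * (dpow p (u 0 t) * u 0 t)) <= \sum_(t < d) `|w 0 t| `^ p.
  by apply: ler_sum => t _; have := normr_tangent (u 0 t) (w 0 t) p1; lra.
rewrite sumrB big_split /= -2!mulr_sumr -(lp_powR u p0) -(lp_powR w p0).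
rewrite sum_dpow_self //.
by set s := \sum_(t < d) _; lra.
Qed.

(** Rescaling w to the norm of u turns the additive inequality
    sum_normr_tangent into Hoelder's inequality. *)
Lemma lp_hoelder p u w : 1 <= p ->
  \sum_(t < d) dpow p (u 0 t) * w 0 t <= lp p u `^ (p - 1) * lp p w.
Proof.
move=> p1; have p0 : 0 < p by lra.
have [->|u0] := eqVneq u 0.
  rewrite big1 ?mulr_ge0 ?powR_ge0 ?lp_ge0 // => t _; by rewrite mxE dpow0 mul0r.
have [->|w0] := eqVneq w 0.
  by rewrite big1 ?mulr_ge0 ?powR_ge0 ?lp_ge0 // => t _; rewrite mxE mulr0.
have Nu : 0 < lp p u by rewrite lp_gt0.
have Nw : 0 < lp p w by rewrite lp_gt0.
have := sum_normr_tangent u ((lp p u / lp p w) *: w) p1.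
have r0 : 0 < lp p u / lp p w by rewrite divr_gt0.
rewrite lpZ // gtr0_norm // divfK ?gt_eqF //.
under eq_bigr => t _ do rewrite mxE mulrCA.
rewrite -mulr_sumr; set s := \sum_(t < d) _ => h.
have {h} : p * (lp p u / lp p w * s) <= p * lp p u `^ p by lra.
by rewrite ler_pM2l // mulrAC -mulrA -(mulr_powRB1 (lp_ge0 p u) p0) ler_pM2l //
  ler_pdivrMr.
Qed.

(** After rescaling w to the norm of u, the gaps in the coordinatewise tangent
    inequalities are nonnegative and add up to 0, so each of them vanishes. *)
Lemma lp_hoelder_eq p u w : 1 < p -> u != 0 ->
  \sum_(t < d) dpow p (u 0 t) * w 0 t = lp p u `^ (p - 1) * lp p w ->
  exists s, w = s *: u.
Proof.
move=> p1 u0; have p0 : 0 < p by lra.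
have [->|w0] := eqVneq w 0; first by exists 0; rewrite scale0r.
have Nu : 0 < lp p u by rewrite lp_gt0.
have Nw : 0 < lp p w by rewrite lp_gt0.
move=> heq; pose r := lp p u / lp p w.
have r0 : 0 < r by rewrite divr_gt0.
suff uE : u = r *: w.
  by exists r^-1; rewrite uE scalerA mulVf ?gt_eqF // scale1r.
have nrw : lp p (r *: w) = lp p u.
  by rewrite lpZ // gtr0_norm // divfK ?gt_eqF.
pose gap t := `|(r *: w) 0 t| `^ p -
  (`|u 0 t| `^ p + p * dpow p (u 0 t) * ((r *: w) 0 t - u 0 t)).
have gap0 t : 0 <= gap t by rewrite subr_ge0 normr_tangent // ltW.
have sum0 : \sum_(t < d) gap t = 0.
  have e : \sum_(t < d) dpow p (u 0 t) * (r *: w) 0 t = lp p u `^ p.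
    under eq_bigr => t _ do rewrite mxE mulrCA.
    rewrite -mulr_sumr heq -(mulr_powRB1 (lp_ge0 p u) p0) /r.
    by rewrite mulrCA divfK ?gt_eqF // mulrC.
  have gapE t : gap t = `|(r *: w) 0 t| `^ p - `|u 0 t| `^ p +
      (p * (dpow p (u 0 t) * u 0 t) - p * (dpow p (u 0 t) * (r *: w) 0 t)).
    by rewrite /gap; ring.
  rewrite (eq_bigr _ (fun t _ => gapE t)) big_split /= 2!sumrB -2!mulr_sumr.
  rewrite -(lp_powR u p0) -(lp_powR (r *: w) p0) nrw e.
  by rewrite sum_dpow_self //; ring.
apply/rowP => t; apply: (@normr_tangent_eq _ p) => //.
have /eqP := sum0; rewrite psumr_eq0 // => /allP /(_ t (mem_index_enum _)).
by rewrite /= subr_eq0 => /eqP.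
Qed.

(** A subgradient of N^q at u for the p-norm N: the gradient where there is one,
    and 0 at u = 0. *)
Definition lp_grad p q u (t : 'I_d) : R :=
  q * lp p u `^ (q - p) * dpow p (u 0 t).

Lemma lp_gradE p q u v :
  \sum_(t < d) lp_grad p q u t * v 0 t =
  q * lp p u `^ (q - p) * \sum_(t < d) dpow p (u 0 t) * v 0 t.
Proof.
by rewrite mulr_sumr; apply: eq_bigr => t _; rewrite /lp_grad !mulrA.
Qed.

Lemma lp_grad0 p q t : lp_grad p q 0 t = 0.
Proof. by rewrite /lp_grad mxE dpow0 mulr0. Qed.

(** N(w)^q lies above its scalar tangent, taken as a function of N(w) at N(u).
    Keeping the Hoelder defect as a term of its own, instead of dropping it at
    once, gives both the tangent inequality and its equality case. *)
Lemma lp_tangent_chain p q u w : 1 <= p -> 1 <= q -> u != 0 ->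
  \sum_(t < d) lp_grad p q u t * (w - u) 0 t +
    q * lp p u `^ (q - p) * (lp p u `^ (p - 1) * lp p w -
                                 \sum_(t < d) dpow p (u 0 t) * w 0 t)
  <= lp p w `^ q - lp p u `^ q.
Proof.
move=> p1 q1 u0; have p0 : 0 < p by lra.
have Nu : lp p u != 0 by rewrite lp_eq0.
have := powR_tangent q1 (lp_ge0 p u) (lp_ge0 p w).
rewrite lp_gradE.
under eq_bigr => t _ do rewrite !mxE mulrBr.
rewrite sumrB sum_dpow_self //; set s := \sum_(t < d) _.
have e1 : lp p u `^ (q - p) * lp p u `^ (p - 1) = lp p u `^ (q - 1).
  by rewrite powR_subr //; congr powR; lra.
have e2 : lp p u `^ (q - p) * lp p u `^ p =
   lp p u `^ (q - 1) * lp p u.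
  by rewrite powR_subr // subrK mulrC mulr_powRB1 ?lp_ge0 //; lra.
move=> h.
have -> : q * lp p u `^ (q - p) * (s - lp p u `^ p) +
   q * lp p u `^ (q - p) * (lp p u `^ (p - 1) * lp p w - s) =
   q * ((lp p u `^ (q - p) * lp p u `^ (p - 1)) * lp p w -
   lp p u `^ (q - p) * lp p u `^ p) by ring.
rewrite e1 e2; lra.
Qed.

Lemma lp_tangent p q u w : 1 <= p -> 1 <= q ->
  \sum_(t < d) lp_grad p q u t * (w - u) 0 t <= lp p w `^ q - lp p u `^ q.
Proof.
move=> p1 q1; have p0 : 0 < p by lra.
have [->|u0] := eqVneq u 0.
  rewrite big1 => [|t _]; last by rewrite lp_grad0 mul0r.
  by rewrite lp0 // (@powR0 _ q) ?subr0 ?powR_ge0 // gt_eqF //; lra.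
apply: le_trans (lp_tangent_chain w p1 q1 u0).
rewrite lerDl !mulr_ge0 ?powR_ge0 ?subr_ge0 ?lp_hoelder //; lra.
Qed.

Lemma lp_tangent_eq p q u w : 1 < p -> 1 <= q -> u != 0 ->
  \sum_(t < d) lp_grad p q u t * (w - u) 0 t = lp p w `^ q - lp p u `^ q ->
  exists s, w = s *: u.
Proof.
move=> p1 q1 u0 heq; have p0 : 0 < p by lra.
have := lp_tangent_chain w (ltW p1) q1 u0; rewrite -heq gerDl.
have Nu : 0 < q * lp p u `^ (q - p).
  by rewrite mulr_gt0 ?powR_gt0 ?lp_gt0 //; lra.
rewrite pmulr_rle0 // subr_le0 => h.
apply: (lp_hoelder_eq p1 u0); apply/eqP.
by rewrite eq_le h lp_hoelder // ltW.
Qed.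

(** Concavity of a^(q/p) bounds N(w)^q by an affine function of N(w)^p, and
    concavity of a^(p/2) bounds each |w_t|^p by an affine function of w_t^2. *)
Lemma lp_majorize p q u w : 1 <= p < 2 -> 1 <= q <= p -> u != 0 ->
  (forall t, u 0 t != 0) ->
  lp p w `^ q - lp p u `^ q <=
  q / 2 * (lp p u `^ (q - p) *
    \sum_(t < d) `|u 0 t| `^ (p - 2) * (w 0 t ^+ 2 - u 0 t ^+ 2)).
Proof.
move=> /andP[p1 p2] /andP[q1 qp] u0 ut0.
have p0 : 0 < p by lra.
have Nu : 0 < lp p u by rewrite lp_gt0.
have qp1 : 0 < q / p <= 1.
  by rewrite divr_gt0 ?ler_pdivrMr ?mul1r //=; lra.
have := powR_tangent_concave qp1 (powR_gt0 p Nu) (powR_ge0 (lp p w) p).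
rewrite -!powRrM.
rewrite (_ : p * (q / p) = q); last by rewrite mulrC divfK // gt_eqF.
rewrite (_ : p * (q / p - 1) = q - p); last first.
  by rewrite mulrBr mulr1 mulrC divfK // gt_eqF.
rewrite addrC -lerBlDr => h; apply: le_trans h _.
rewrite (_ : q / 2 * _ = q / p * lp p u `^ (q - p) *
   (p / 2 * \sum_(t < d) `|u 0 t| `^ (p - 2) * (w 0 t ^+ 2 - u 0 t ^+ 2))).
  apply: ler_wpM2l; first by rewrite mulr_ge0 ?powR_ge0 // ltW //; case/andP: qp1.
  rewrite !lp_powR // -sumrB mulr_sumr; apply: ler_sum => t _.
  have hp2 : 0 < p / 2 <= 1 by apply/andP; split; lra.
  have ut : 0 < `|u 0 t| by rewrite normr_gt0.
  have sq z : `|z| ^+ 2 = `|z : R| `^ 2 by rewrite -(@powR_mulrn _ _ 2).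
  have := powR_tangent_concave hp2 (powR_gt0 2 ut) (powR_ge0 `|w 0 t| 2).
  rewrite -!powRrM.
  rewrite (_ : 2 * (p / 2) = p); last by lra.
  rewrite (_ : 2 * (p / 2 - 1) = p - 2); last by lra.
  by rewrite -!sq !real_normK ?num_real // mulrA; lra.
set s := \sum_(t < d) _.
rewrite (_ : q / p * lp p u `^ (q - p) * (p / 2 * s) =
  q / 2 * (p * p^-1) * (lp p u `^ (q - p) * s)); last by ring.
by rewrite divff ?gt_eqF // mulr1.
Qed.

(** Every b is the vector of the values dpow p (u_t) for some u, and its dual
    norm is then the factor in front of N(w) in Hoelder's inequality; so that
    inequality and its equality at w = u describe the dual unit ball. *)
Lemma lp_dual_vector p b : 1 < p ->
  exists2 u : 'rV[R]_d, forall t, dpow p (u 0 t) = b 0 t &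
    lp p u `^ (p - 1) = lp (conj_exponent p) b.
Proof.
move=> p1; have p0 : 0 < p by lra.
have p10 : 0 < p - 1 by lra.
have rE : conj_exponent p = p / (p - 1).
  have e : 1 - p^-1 = (p - 1) / p by rewrite mulrBl divff ?gt_eqF // mul1r.
  by rewrite /conj_exponent e invf_div.
pose u : 'rV[R]_d := \row_t (Num.sg (b 0 t) * `|b 0 t| `^ (p - 1)^-1).
have nu t : `|u 0 t| = `|b 0 t| `^ (p - 1)^-1.
  rewrite mxE normrM (ger0_norm (powR_ge0 _ _)) normr_sg.
  have [->|b0] := eqVneq (b 0 t) 0; last by rewrite mul1r.
  by rewrite mul0r normr0 powR0 // invr_eq0 gt_eqF.
exists u => [t|].
  rewrite dpowE nu -powRrM mulVf ?gt_eqF // powRr1 // mxE sgrM sgr_id.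
  have [->|b0] := eqVneq (b 0 t) 0; first by rewrite sgr0 !mul0r.
  rewrite (gtr0_sg (powR_gt0 _ _)) ?normr_gt0 // mulr1 -numEsg //.
rewrite !lpE -powRrM rE invf_div mulrC; congr (_ `^ _).
apply: eq_bigr => t _; rewrite nu -powRrM; congr (_ `^ _).
by rewrite mulrC.
Qed.

Lemma lp_dual_ball p b : 1 < p ->
  lp (conj_exponent p) b <= 1 <->
  forall w, \sum_(t < d) b 0 t * w 0 t <= lp p w.
Proof.
move=> p1; have p0 : 0 < p by lra.
have [u uE <-] := lp_dual_vector b p1; split=> [u1 w|h].
  under eq_bigr => t _ do rewrite -uE.
  apply: le_trans (lp_hoelder u w (ltW p1)) _.
  by rewrite ler_piMl ?lp_ge0.
have := h u; under eq_bigr => t _ do rewrite -uE.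
rewrite sum_dpow_self // -(mulr_powRB1 (lp_ge0 p u)) //.
have [u0|/negPf u0] := eqVneq u 0.
  by rewrite u0 lp0 // (@powR0 _ (p - 1)) // gt_eqF //; lra.
rewrite -[X in _ <= X]mulr1 ler_pM2l //.
by rewrite lp_gt0 // u0.
Qed.

End LpNorm.

(** * The cost: subgradients, strict convexity and descent *)

Section Cost.
Variables (R : realType) (d m : nat) (x : 'I_m -> 'rV[R]_d) (eta : 'I_m -> R).
Variables (p q : R).
Hypotheses (eta_gt0 : forall i, 0 < eta i).
Hypotheses (p_ge1 : 1 <= p) (q_ge1 : 1 <= q).
Implicit Types (y z v : 'rV[R]_d) (i : 'I_m) (t : 'I_d).

Let p_gt0 : 0 < p. Proof. exact: lt_le_trans ltr01 p_ge1. Qed.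
Let q_gt0 : 0 < q. Proof. exact: lt_le_trans ltr01 q_ge1. Qed.
Let etaq_gt0 i : 0 < eta i `^ q. Proof. exact: powR_gt0. Qed.

Notation C := (cost x eta p q).

Lemma costE y : C y = \sum_i eta i `^ q * lp p (y - x i) `^ q.
Proof. by rewrite lp.unlock. Qed.

Lemma cost_ge0 y : 0 <= C y.
Proof.
by rewrite costE; apply: sumr_ge0 => i _; rewrite mulr_ge0 ?powR_ge0.
Qed.

Lemma gradDE y t :
  gradD x eta p q y 0 t = \sum_i eta i `^ q * lp_grad p q (y - x i) t.
Proof.
rewrite mxE big_mkcond /=; apply: eq_bigr => i _.
rewrite /lp_grad lp.unlock !mxE; case: ifPn => [_|].
  by rewrite /dpow -!mulrA mulrCA.
by rewrite negbK inE => /eqP ->; rewrite subrr dpow0 !mulr0.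
Qed.

Lemma gradD_dot y v : \sum_t gradD x eta p q y 0 t * v 0 t =
  \sum_i eta i `^ q * \sum_t lp_grad p q (y - x i) t * v 0 t.
Proof.
under eq_bigr => t _ do rewrite gradDE mulr_suml.
rewrite exchange_big /=; apply: eq_bigr => i _.
by rewrite mulr_sumr; apply: eq_bigr => t _; rewrite mulrA.
Qed.

Lemma cost_tangent y z :
  \sum_t gradD x eta p q y 0 t * (z - y) 0 t <= C z - C y.
Proof.
rewrite gradD_dot !costE -sumrB; apply: ler_sum => i _.
rewrite -mulrBr ler_pM2l //.
by rewrite (_ : z - y = z - x i - (y - x i)) ?lp_tangent // opprB addrA subrK.
Qed.

Lemma gradD_subgradient y : subdifferential C y (gradD x eta p q y).
Proof.
move=> z; apply: le_trans (cost_tangent y z).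
by rewrite le_eqVlt; apply/orP; left; apply/eqP/eq_bigr => t _; rewrite !mxE.
Qed.

Lemma minimum_subdifferential0 y :
  is_minimum_point C y <-> subdifferential C y 0.
Proof.
have sum0 z : \sum_t (0 : 'rV[R]_d) 0 t * (z 0 t - y 0 t) = 0.
  by rewrite big1 // => t _; rewrite mxE mul0r.
by split=> h z; have := h z; rewrite ?sum0 subr_ge0.
Qed.

(** Equality would hold term by term, so for each data point x_i <> y there
    would be s with z - x_i = s (y - x_i); here s <> 1 as y <> z, which puts x_i
    on the line through y and z. *)
Lemma cost_tangent_strict y z : ~ collinear x -> 1 < p -> y != z ->
  \sum_t gradD x eta p q y 0 t * (z - y) 0 t < C z - C y.
Proof.
move=> ncol p_gt1 yz; rewrite lt_neqAle cost_tangent andbT.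
apply/eqP; rewrite gradD_dot !costE -sumrB => heq; apply: ncol.
pose gap i := eta i `^ q * lp p (z - x i) `^ q - eta i `^ q * lp p (y - x i) `^ q
  - eta i `^ q * \sum_t lp_grad p q (y - x i) t * (z - y) 0 t.
have gap_ge0 i : 0 <= gap i.
  rewrite subr_ge0 -mulrBr ler_pM2l //.
  by rewrite (_ : z - y = z - x i - (y - x i)) ?lp_tangent // opprB addrA subrK.
have /eqP : \sum_i gap i = 0 by rewrite sumrB -heq subrr.
rewrite psumr_eq0 // => /allP gap0.
exists y, (z - y) => i; have := gap0 i (mem_index_enum _).
rewrite /= subr_eq0 -mulrBr (inj_eq (mulfI (lt0r_neq0 (etaq_gt0 i)))) => /eqP e.
have [yxi|yxi] := eqVneq y (x i); first by exists 0; rewrite scale0r addr0.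
have yxi0 : y - x i != 0 by rewrite subr_eq0.
have [|s zE] := @lp_tangent_eq _ _ p q (y - x i) (z - x i) p_gt1 q_ge1 yxi0.
  by rewrite e (_ : z - y = z - x i - (y - x i)) // opprB addrA subrK.
have s1 : 1 - s != 0.
  rewrite subr_eq0; apply: contra_neq yz => s1; move: zE; rewrite -s1 scale1r.
  by move/addIr.
exists (1 - s)^-1; apply: (scalerI s1).
rewrite scalerDr scalerA divff // scale1r.
have -> : z = x i + s *: (y - x i) by rewrite -zE addrC subrK.
by apply/rowP => t; rewrite !mxE; ring.
Qed.

Lemma noncollinear_card_gt0 : ~ collinear x -> (0 < m)%N.
Proof.
move=> ncol; rewrite lt0n; apply/eqP => m0; apply: ncol.
have noidx k : (k < m)%N = false by rewrite m0.
by exists 0, 0 => i; have := noidx i; rewrite ltn_ord.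
Qed.

Lemma nonsingular_coord y : ~ singular_set x y -> forall i t, y 0 t != x i 0 t.
Proof. by move=> yS i t; apply/eqP => e; apply: yS; exists i, t. Qed.

Lemma coord_neq_sub y i t : y 0 t != x i 0 t -> y - x i != 0.
Proof. by apply: contra_neq => /subr0_eq ->. Qed.

Lemma nonsingular_neq y i : ~ collinear x -> ~ singular_set x y -> y - x i != 0.
Proof.
move=> ncol yS; rewrite subr_eq0; apply/eqP => yE; apply: ncol.
exists 0, 0 => j; exists 0; apply/rowP => t.
by case: yS; exists i, t; rewrite yE.
Qed.

Definition weight y i t :=
  eta i `^ q * lp p (y - x i) `^ (q - p) * `|y 0 t - x i 0 t| `^ (p - 2).

Lemma T_opE y t : T_op x eta p q y 0 t =
  (\sum_i weight y i t * x i 0 t) / \sum_i weight y i t.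
Proof. by rewrite /weight lp.unlock mxE. Qed.

Lemma weight_ge0 y i t : 0 <= weight y i t.
Proof. by rewrite !mulr_ge0 ?powR_ge0. Qed.

Lemma weight_gt0 y i t : y 0 t != x i 0 t -> 0 < weight y i t.
Proof.
move=> yt; rewrite !mulr_gt0 ?powR_gt0 //; last by rewrite normr_gt0 subr_eq0.
by rewrite lp_gt0 // (coord_neq_sub yt).
Qed.

Lemma sum_weight_gt0 y t : (0 < m)%N -> (forall i, y 0 t != x i 0 t) ->
  0 < \sum_i weight y i t.
Proof.
move=> m0 yt; rewrite (bigD1 (Ordinal m0)) //= ltr_wpDr ?weight_gt0 //.
by apply: sumr_ge0 => i _; exact: weight_ge0.
Qed.

Lemma gradD_weight y t :
  gradD x eta p q y 0 t = q * \sum_i weight y i t * (y 0 t - x i 0 t).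
Proof.
rewrite gradDE mulr_sumr; apply: eq_bigr => i _.
by rewrite /lp_grad /weight /dpow [(y - x i) 0 t]mxE [(- x i) 0 t]mxE; ring.
Qed.

(** In a nonsingular coordinate the fixed-point map is a gradient step, with
    step size 1 / (q * sum of the weights). *)
Lemma gradD_T_op y t : (0 < m)%N -> (forall i, y 0 t != x i 0 t) ->
  gradD x eta p q y 0 t =
  q * (\sum_i weight y i t) * (y 0 t - T_op x eta p q y 0 t).
Proof.
move=> m0 yt; have B0 := sum_weight_gt0 m0 yt.
rewrite gradD_weight T_opE -mulrA; congr (_ * _).
rewrite mulrBr [in RHS]mulrC [X in _ - X]mulrC divfK ?gt_eqF // mulr_sumr -sumrB.
by apply: eq_bigr => i _; ring.
Qed.

Lemma gradD_eq0 y t : (0 < m)%N -> (forall i, y 0 t != x i 0 t) ->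
  (gradD x eta p q y 0 t == 0) = (T_op x eta p q y 0 t == y 0 t).
Proof.
move=> m0 yt; have B0 := sum_weight_gt0 m0 yt.
by rewrite gradD_T_op // !mulf_eq0 (gt_eqF q_gt0) (gt_eqF B0) subr_eq0 eq_sym.
Qed.

Lemma cost_majorize y z : p < 2 -> q <= p -> ~ collinear x ->
  ~ singular_set x y ->
  C z - C y <= q / 2 * \sum_t \sum_i weight y i t *
     ((z 0 t - x i 0 t) ^+ 2 - (y 0 t - x i 0 t) ^+ 2).
Proof.
move=> p_lt2 q_le_p ncol yS; rewrite exchange_big !costE -sumrB mulr_sumr /=.
apply: ler_sum => i _; rewrite -mulrBr.
have p12 : 1 <= p < 2 by rewrite p_ge1.
have q1p : 1 <= q <= p by rewrite q_ge1.
have yx t : (y - x i) 0 t != 0.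
  by rewrite !mxE subr_eq0; exact: nonsingular_coord.
have := lp_majorize (z - x i) p12 q1p (nonsingular_neq i ncol yS) yx.
move=> /(ler_wpM2l (ltW (etaq_gt0 i))) h; apply: le_trans h _.
rewrite mulrCA le_eqVlt; apply/orP; left; apply/eqP; congr (_ * _).
rewrite mulrA mulr_sumr; apply: eq_bigr => t _.
by rewrite /weight !mxE mulrA.
Qed.

(** In each coordinate T y minimizes the quadratic majorant, a weighted sum of
    the squares (z_t - x_it)^2, so completing the square gives the exact
    decrease of the majorant. *)
Lemma cost_descent y : p < 2 -> q <= p -> ~ collinear x ->
  ~ singular_set x y ->
  q / 2 * \sum_t (\sum_i weight y i t) * (T_op x eta p q y 0 t - y 0 t) ^+ 2
  <= C y - C (T_op x eta p q y).
Proof.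
move=> p_lt2 q_le_p ncol yS.
have := cost_majorize (T_op x eta p q y) p_lt2 q_le_p ncol yS.
rewrite -lerN2 opprB; apply: le_trans; rewrite -mulrN -sumrN.
rewrite le_eqVlt; apply/orP; left; apply/eqP; congr (_ * _).
apply: eq_bigr => t _; set T := T_op _ _ _ _ _ 0 t.
have B0 : 0 < \sum_i weight y i t.
  apply: sum_weight_gt0 => [|i]; first exact: noncollinear_card_gt0.
  exact: nonsingular_coord.
have TE : \sum_i weight y i t * x i 0 t = (\sum_i weight y i t) * T.
  by rewrite /T T_opE mulrC divfK // gt_eqF.
under [in RHS]eq_bigr => i _.
  rewrite (_ : weight y i t * _ = weight y i t * (T ^+ 2 - y 0 t ^+ 2) -
    weight y i t * x i 0 t * (2 * (T - y 0 t))); last by ring.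
over.
by rewrite sumrB -!mulr_suml TE; ring.
Qed.

Lemma cost_T_op y : p < 2 -> q <= p -> ~ collinear x ->
  ~ singular_set x y -> C (T_op x eta p q y) <= C y.
Proof.
move=> p_lt2 q_le_p ncol yS; rewrite -subr_ge0.
apply: le_trans (cost_descent p_lt2 q_le_p ncol yS).
rewrite mulr_ge0 ?sumr_ge0 ?divr_ge0 ?ltW // => t _.
by rewrite mulr_ge0 ?sqr_ge0 // sumr_ge0 // => i _; exact: weight_ge0.
Qed.

Lemma level_bound M : exists2 D, 0 < D & forall y, C y <= M ->
  forall i, lp p (y - x i) <= D.
Proof.
pose D i := (M / eta i `^ q) `^ q^-1.
have D0 i : 0 <= D i by exact: powR_ge0.
exists (1 + \sum_i D i) => [|y yM i].
  by rewrite ltr_wpDr // sumr_ge0.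
have Ci : eta i `^ q * lp p (y - x i) `^ q <= C y.
  rewrite costE (bigD1 i) //= lerDl sumr_ge0 // => j _.
  by rewrite mulr_ge0 ?powR_ge0.
have {}Ci : lp p (y - x i) `^ q <= M / eta i `^ q.
  by rewrite ler_pdivlMr // mulrC (le_trans Ci).
have le_D : lp p (y - x i) <= D i.
  rewrite -[leLHS]powRr1 ?lp_ge0 // -(divff (lt0r_neq0 q_gt0)) powRrM.
  have M0 := le_trans (powR_ge0 _ _) Ci.
  by rewrite ge0_ler_powR ?invr_ge0 ?nnegrE ?powR_ge0 // ltW.
apply: (le_trans le_D); rewrite (bigD1 i) //= addrCA lerDl.
by rewrite addr_ge0 // sumr_ge0.
Qed.

(** On a sublevel set the distances to the data are bounded, and the exponents
    q - p and p - 2 of the weights are nonpositive, so the weights are bounded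
    below. *)
Lemma level_descent M : p < 2 -> q <= p -> ~ collinear x ->
  exists2 k, 0 < k & forall y, C y <= M -> ~ singular_set x y ->
    forall t, k * (T_op x eta p q y 0 t - y 0 t) ^+ 2 <=
      C y - C (T_op x eta p q y).
Proof.
move=> p_lt2 q_le_p ncol; have [D D0 yD] := level_bound M.
have m0 := noncollinear_card_gt0 ncol; pose i0 := Ordinal m0.
pose w0 := eta i0 `^ q * D `^ (q - p) * D `^ (p - 2).
have w00 : 0 < w0 by rewrite !mulr_gt0 ?powR_gt0.
exists (q / 2 * w0) => [|y yM yS t]; first by rewrite mulr_gt0 ?divr_gt0.
apply: le_trans (cost_descent p_lt2 q_le_p ncol yS).
rewrite -(mulrA (q / 2)) ler_pM2l ?divr_gt0 // (bigD1 t) //=.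
apply: ler_wpDr.
  apply: sumr_ge0 => s _; rewrite mulr_ge0 ?sqr_ge0 // sumr_ge0 // => i _.
  exact: weight_ge0.
rewrite ler_wpM2r ?sqr_ge0 // (bigD1 i0) //= ler_wpDr //.
  by apply: sumr_ge0 => i _; exact: weight_ge0.
have ut : 0 < `|y 0 t - x i0 0 t|.
  by rewrite normr_gt0 subr_eq0 nonsingular_coord.
have utl : `|y 0 t - x i0 0 t| <= lp p (y - x i0).
  by have := lp_coord (y - x i0) t p_gt0; rewrite !mxE.
have lD := yD _ yM i0.
rewrite /w0 /weight -!mulrA ler_pM2l // ler_pM ?powR_ge0 //.
  by apply: powR_anti; rewrite ?subr_le0 // (lt_le_trans ut).
by apply: powR_anti => //; [exact: le_trans lD | rewrite subr_le0 ltW].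
Qed.

End Cost.

(** * Continuity of powers and of the p-norm *)

Section Continuity.
Variables (R : realType) (T : Type) (F : set_system T).
Context {FF : Filter F}.
Implicit Types (f g : T -> R) (a e p : R).

Lemma cvg_powR_gt0 f a e : 0 < a -> f @ F --> a ->
  (fun s => f s `^ e) @ F --> a `^ e.
Proof.
move=> a0; apply: (@continuous_cvg _ _ _ F FF f (fun b => b `^ e)).
apply: differentiable_continuous; apply/derivable1_diffP.
by apply: derivable_powR; rewrite in_itv /= andbT.
Qed.

Lemma cvg_normr_powR f a e : a != 0 \/ 0 < e -> f @ F --> a ->
  (fun s => `|f s| `^ e) @ F --> `|a| `^ e.
Proof.
move=> ae fa; have [a0|a0] := eqVneq a 0; last first.
  by apply: cvg_powR_gt0; [rewrite normr_gt0 | exact: cvg_norm].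
have e0 : 0 < e by case: ae => //; rewrite a0 eqxx.
rewrite a0 normr0 powR0 ?gt_eqF //; apply/cvgr0Pnorm_lt => eps eps0.
have eps'0 : 0 < eps `^ e^-1 by exact: powR_gt0.
rewrite a0 in fa; move/cvgr0Pnorm_lt : fa => /(_ _ eps'0).
apply: filterS => s fs.
rewrite ger0_norm ?powR_ge0 // -[ltRHS](powRr1 (ltW eps0)).
rewrite -(mulVf (lt0r_neq0 e0)) powRrM.
by rewrite gt0_ltr_powR // nnegrE ?powR_ge0.
Qed.

Lemma cvg_dpow f a p : a != 0 \/ 1 < p -> f @ F --> a ->
  (fun s => dpow p (f s)) @ F --> dpow p a.
Proof.
move=> ap fa; have [a0|a0] := eqVneq a 0; last first.
  by apply: cvgM => //; apply: cvg_normr_powR => //; left.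
have p1 : 0 < p - 1 by case: ap => [|p1]; [rewrite a0 eqxx | lra].
rewrite a0 dpow0; apply: norm_cvg0.
have := cvg_normr_powR (or_intror p1) fa.
rewrite a0 normr0 powR0 ?gt_eqF //; apply: cvg_trans.
apply: near_eq_cvg; near=> s.
have [->|fs] := eqVneq (f s) 0; last by rewrite normr_dpow.
by rewrite dpow0 !normr0 powR0 // gt_eqF.
Unshelve. all: by end_near. Qed.

Lemma cvg_sumr (I : Type) (r : seq I) (P : pred I) (h : I -> T -> R) (a : I -> R) :
  (forall i, P i -> h i @ F --> a i) ->
  (fun s => \sum_(i <- r | P i) h i s) @ F --> \sum_(i <- r | P i) a i.
Proof. by move=> ha; apply: cvg_big => //; exact: add_continuous. Qed.

Variable d : nat.
Implicit Types (v : T -> 'rV[R]_d) (u : 'rV[R]_d).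

Lemma cvg_lp v u p : 0 < p -> (forall t, (fun s => v s 0 t) @ F --> u 0 t) ->
  (fun s => lp p (v s)) @ F --> lp p u.
Proof.
move=> p0 vu; rewrite lpE.
rewrite (_ : (fun s => _) =
    fun s => `|\sum_(t < d) `|v s 0 t| `^ p| `^ p^-1); last first.
  by apply/funext => s; rewrite lpE ger0_norm ?sum_powR_ge0.
rewrite -(ger0_norm (sum_powR_ge0 _ _)).
apply: cvg_normr_powR; first by right; rewrite invr_gt0.
by apply: cvg_sumr => t _; apply: cvg_normr_powR => //; right.
Qed.

Lemma cvg_lp_powR v u p e : 0 < p -> u != 0 \/ 0 < e ->
  (forall t, (fun s => v s 0 t) @ F --> u 0 t) ->
  (fun s => lp p (v s) `^ e) @ F --> lp p u `^ e.
Proof.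
move=> p0 ue vu; rewrite -(ger0_norm (lp_ge0 p u)).
rewrite (_ : (fun s => _) = fun s => `|lp p (v s)| `^ e); last first.
  by apply/funext => s; rewrite ger0_norm ?lp_ge0.
apply: cvg_normr_powR; last exact: cvg_lp.
by case: ue; [left; rewrite lp_eq0 | right].
Qed.

Lemma cvg_lp_grad v u p q t : 0 < p -> u != 0 -> u 0 t != 0 \/ 1 < p ->
  (forall t, (fun s => v s 0 t) @ F --> u 0 t) ->
  (fun s => lp_grad p q (v s) t) @ F --> lp_grad p q u t.
Proof.
move=> p0 u0 ut vu; apply: cvgM; last exact: cvg_dpow.
by apply: cvgM; [exact: cvg_cst | apply: cvg_lp_powR => //; left].
Qed.

End Continuity.

(** * Uniqueness of subgradients *)

Section Subdifferential.
Variables (R : realType) (d m : nat) (x : 'I_m -> 'rV[R]_d) (eta : 'I_m -> R).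
Variables (p q : R).
Hypotheses (eta_gt0 : forall i, 0 < eta i).
Hypotheses (p_ge1 : 1 <= p) (q_ge1 : 1 <= q).
Implicit Types (y z v h u : 'rV[R]_d) (i : 'I_m) (t : 'I_d).

Let p_gt0 : 0 < p. Proof. exact: lt_le_trans ltr01 p_ge1. Qed.
Let q_gt0 : 0 < q. Proof. exact: lt_le_trans ltr01 q_ge1. Qed.
Let etaq_gt0 i : 0 < eta i `^ q. Proof. exact: powR_gt0. Qed.

Notation C := (cost x eta p q).

Let cvg_right0 : s @[s --> (0 : R)^'+] --> (0 : R).
Proof. exact: (@cvg_at_right_filter R R id 0 0 (fun A => id)). Qed.

(** k bounds the right derivative of N^q at u along h, in a form that only
    asks for the limit of a bound of the difference quotients. *)
Definition slope_le u h (k : R) := exists K : R -> R,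
  K s @[s --> 0^'+] --> k /\
  forall s, 0 < s -> lp p (u + s *: h) `^ q - lp p u `^ q <= s * K s.

(** The subgradient inequality at y + s h, divided by s, in the limit. *)
Lemma subgradient_slope_le y v h (k : 'I_m -> R) : subdifferential C y v ->
  (forall i, slope_le (y - x i) h (k i)) ->
  \sum_t v 0 t * h 0 t <= \sum_i eta i `^ q * k i.
Proof.
move=> vy hk; have [K KP] := choice hk.
have cK : \sum_i eta i `^ q * K i s @[s --> 0^'+] --> \sum_i eta i `^ q * k i.
  by apply: cvg_sumr => i _; apply: cvgMl_tmp; case: (KP i).
apply: (cvgr_to_ge cK); near=> s.
have s0 : 0 < s by near: s; exact: nbhs_right_gt.
rewrite -(ler_pM2l s0) mulr_sumr.
rewrite (eq_bigr (fun t => v 0 t * ((y + s *: h) 0 t - y 0 t))); last first.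
  by move=> t _; rewrite !mxE; ring.
apply: le_trans (vy (y + s *: h)) _.
rewrite !costE -sumrB mulr_sumr; apply: ler_sum => i _.
rewrite -mulrBr mulrCA ler_pM2l // -addrAC.
by have [_ ->] := KP i.
Unshelve. all: by end_near. Qed.

(** The tangent inequality at u + s h, evaluated at u. *)
Lemma lp_forward u h s : lp p (u + s *: h) `^ q - lp p u `^ q <=
  s * \sum_t lp_grad p q (u + s *: h) t * h 0 t.
Proof.
rewrite -lerN2 opprB; apply: le_trans (lp_tangent (u + s *: h) u p_ge1 q_ge1).
rewrite le_eqVlt; apply/orP; left; apply/eqP.
rewrite mulr_sumr -sumrN; apply: eq_bigr => t _.
by rewrite opprD addrA subrr sub0r !mxE; ring.
Qed.

(** For p = 1 the slope in coordinate t jumps at u_t = 0, which does no harm if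
    h does not move that coordinate. *)
Lemma slope_le_grad u h : u != 0 -> (forall t, h 0 t != 0 -> u 0 t != 0 \/ 1 < p) ->
  slope_le u h (\sum_t lp_grad p q u t * h 0 t).
Proof.
move=> u0 hu; exists (fun s => \sum_t lp_grad p q (u + s *: h) t * h 0 t).
split=> [|s _]; last exact: lp_forward.
  apply: cvg_sumr => t _; have [->|ht] := eqVneq (h 0 t) 0.
    by under eq_cvg do rewrite mulr0; rewrite mulr0; exact: cvg_cst.
  apply: cvgMr_tmp; apply: cvg_lp_grad => // [|t']; first exact: hu.
  under eq_cvg do rewrite !mxE.
  have : u 0 t' + s * h 0 t' @[s --> 0^'+] --> u 0 t' + 0 * h 0 t'.
    by apply: cvgD; [exact: cvg_cst | apply: cvgMr_tmp; exact: cvg_right0].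
  by rewrite mul0r addr0.
Qed.

Lemma slope_le0_q1 h : q = 1 -> slope_le 0 h (lp p h).
Proof.
move=> q1; exists (fun=> lp p h); split=> [|s s0]; first exact: cvg_cst.
rewrite add0r lpZ // lp0 // q1 !powRr1 ?mulr_ge0 ?lp_ge0 //.
by rewrite subr0 gtr0_norm.
Qed.

Lemma slope_le0 h : 1 < q -> slope_le 0 h 0.
Proof.
move=> q1; exists (fun s => `|s| `^ (q - 1) * lp p h `^ q); split=> [|s s0].
  have q10 : 0 < q - 1 by rewrite subr_gt0.
  have : `|s| `^ (q - 1) * lp p h `^ q @[s --> 0^'+] -->
      `|0 : R| `^ (q - 1) * lp p h `^ q.
    apply: cvgM; [apply: cvg_normr_powR; first by right | exact: cvg_cst].
    exact: cvg_right0.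
  by rewrite normr0 (powR0 (lt0r_neq0 q10)) mul0r.
rewrite add0r lpZ // lp0 // powRM ?lp_ge0 //.
rewrite (powR0 (lt0r_neq0 q_gt0)) subr0 mulrA.
by rewrite gtr0_norm // mulr_powRB1 // ltW.
Qed.

(** The slope bounds give <v, h> <= <gradD y, h> for every h; take
    h = v - gradD y. *)
Lemma subgradient_unique y v :
  (forall i, y = x i -> 1 < q) -> (forall i t, y 0 t = x i 0 t -> 1 < p) ->
  subdifferential C y v -> v = gradD x eta p q y.
Proof.
move=> yq yp vy; pose h := v - gradD x eta p q y.
have : \sum_t v 0 t * h 0 t <= \sum_t gradD x eta p q y 0 t * h 0 t.
  rewrite gradD_dot; apply: subgradient_slope_le vy _ => i.
  have [yx|yx] := eqVneq (y - x i) 0.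
    rewrite yx big1 => [|t _]; last by rewrite lp_grad0 mul0r.
    by apply/slope_le0/(yq i)/subr0_eq.
  apply: slope_le_grad => // t _.
  have [e|ne] := eqVneq (y 0 t) (x i 0 t); first by right; exact: yp e.
  by left; rewrite !mxE subr_eq0.
rewrite -subr_le0 -sumrB => le0.
have sq t : v 0 t * h 0 t - gradD x eta p q y 0 t * h 0 t = h 0 t ^+ 2.
  by rewrite -mulrBl expr2; congr (_ * _); rewrite [RHS]mxE; congr (_ + _); rewrite [RHS]mxE.
have sum0 : \sum_t h 0 t ^+ 2 = 0.
  apply/eqP; rewrite eq_le sumr_ge0 ?andbT => [|t _]; last exact: sqr_ge0.
  by under eq_bigr => t _ do rewrite -sq.
apply/eqP; rewrite -subr_eq0; apply/eqP/rowP => t; rewrite [RHS]mxE -/h.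
have /eqP := sum0; rewrite psumr_eq0 => [/allP /(_ t (mem_index_enum _))|j _].
  by rewrite /= sqrf_eq0 => /eqP.
exact: sqr_ge0.
Qed.

End Subdifferential.

(** * The explicit subdifferential *)

Section Formula.
Variables (R : realType) (d m : nat) (x : 'I_m -> 'rV[R]_d) (eta : 'I_m -> R).
Hypothesis eta_gt0 : forall i, 0 < eta i.
Implicit Types (y z v h u b : 'rV[R]_d) (i l : 'I_m) (t : 'I_d).

(** The l-th term of the cost contributes eta_l N(h) to the right derivative
    along h, and the others are smooth at x l. So v - gradD must be eta_l times
    a vector b with <b, h> <= N(h) for all h, that is, of dual norm at most 1. *)
Lemma data_point_subgradientP (p : R) l v : injective x -> 1 < p ->
  subdifferential (cost x eta p 1) (x l) v <->
  exists2 b, lp (conj_exponent p) b <= 1 &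
    v = gradD x eta p 1 (x l) + eta l *: b.
Proof.
move=> x_inj p1; have p0 : 0 < p by lra.
have p1' := ltW p1; have le11 : (1 : R) <= 1 by [].
have eta0 i : eta i != 0 by rewrite gt_eqF.
have e1 i : eta i `^ 1 = eta i by rewrite powRr1 // ltW.
have grad0 (w : 'rV[R]_d) : \sum_t lp_grad p 1 (0 : 'rV[R]_d) t * w 0 t = 0.
  by rewrite big1 // => t _; rewrite lp_grad0 mul0r.
split=> [vl|[b b1 ->] z].
  exists ((eta l)^-1 *: (v - gradD x eta p 1 (x l))); last first.
    by rewrite scalerA divff // scale1r addrC subrK.
  apply/(lp_dual_ball _ p1) => h.
  pose k i := if i == l then lp p h else
    \sum_t lp_grad p 1 (x l - x i) t * h 0 t.
  have : \sum_t v 0 t * h 0 t <= \sum_i eta i `^ 1 * k i.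
    apply: subgradient_slope_le vl _ => // i; rewrite /k.
    case: eqVneq => [->|il]; first by rewrite subrr; exact: slope_le0_q1.
    apply: slope_le_grad => // [|t _]; last by right.
    by rewrite subr_eq0; apply: contra_neq il => /x_inj.
  rewrite (bigD1 l) //= {1}/k eqxx e1.
  have -> : \sum_(i < m | i != l) eta i `^ 1 * k i =
      \sum_t gradD x eta p 1 (x l) 0 t * h 0 t.
    rewrite gradD_dot [RHS](bigD1 l) //= subrr.
    rewrite grad0 mulr0 add0r; apply: eq_bigr => i il.
    by rewrite /k (negPf il).
  rewrite -lerBlDr -sumrB -ler_pdivrMl // mulr_sumr.
  apply: le_trans; rewrite le_eqVlt; apply/orP; left; apply/eqP.
  apply: eq_bigr => t _; rewrite -mulrBl mulrA; congr (_ * _).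
  rewrite [LHS]mxE; congr (_ * _); rewrite [LHS]mxE; congr (_ + _).
  by rewrite [LHS]mxE.
pose w : 'rV[R]_d := z - x l.
have -> : \sum_t (gradD x eta p 1 (x l) + eta l *: b) 0 t * (z 0 t - x l 0 t) =
   \sum_t gradD x eta p 1 (x l) 0 t * w 0 t + eta l * \sum_t b 0 t * w 0 t.
  rewrite mulr_sumr -big_split; apply: eq_bigr => t _ /=.
  have -> : w 0 t = z 0 t - x l 0 t by rewrite !mxE.
  by rewrite [X in X * _ = _]mxE [(eta l *: b) 0 t]mxE; ring.
have bw := (iffLR (lp_dual_ball b p1)) b1 w.
rewrite gradD_dot !costE -sumrB (bigD1 l) //= [leRHS](bigD1 l) //= subrr.
rewrite grad0 mulr0 add0r lp0 // (powRr1 (lexx 0)) mulr0 subr0 (powRr1 (lp_ge0 _ _)).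
rewrite [leRHS]addrC; apply: lerD; last by rewrite e1 ler_pM2l.
apply: ler_sum => i _; rewrite -mulrBr e1 ler_pM2l //.
by rewrite (_ : w = z - x i - (x l - x i)) ?lp_tangent // opprB addrA subrK.
Qed.

Lemma lp1E u : lp 1 u = \sum_t `|u 0 t|.
Proof.
rewrite lpE invr1 powRr1 ?sum_powR_ge0 //.
by apply: eq_bigr => t _; rewrite powRr1.
Qed.

Lemma gradD11 y t : gradD x eta 1 1 y 0 t =
  \sum_(i | i \notin V x y t) eta i * dpow 1 (y 0 t - x i 0 t).
Proof.
rewrite gradDE big_mkcond [RHS]big_mkcond; apply: eq_bigr => i _ /=.
rewrite /lp_grad subrr powRr0 !mul1r powRr1 ?ltW // [(y - _) 0 t]mxE.
rewrite [(- x i) 0 t]mxE; case: ifPn => //.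
by rewrite negbK inE => /eqP ->; rewrite subrr dpow0 mulr0.
Qed.

(** The cost is a sum of one-variable functions, one for each coordinate t,
    with a kink of size the total weight of V x y t at y_t; testing a
    subgradient along the two directions of each axis is enough. *)
Lemma cost11_subgradientP y v :
  subdifferential (cost x eta 1 1) y v <->
  forall t, `|v 0 t - gradD x eta 1 1 y 0 t| <= \sum_(i | i \in V x y t) eta i.
Proof.
have le11 : (1 : R) <= 1 by [].
have e1 i : eta i `^ 1 = eta i by rewrite powRr1 // ltW.
split=> [vy t|hv z].
  have dir (e : R) : `|e| = 1 ->
      e * (v 0 t - gradD x eta 1 1 y 0 t) <= \sum_(i | i \in V x y t) eta i.
    move=> e1'; pose h : 'rV[R]_d := \row_j (if j == t then e else 0).
    have ht : h 0 t = e by rewrite mxE eqxx.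
    have hj j : j != t -> h 0 j = 0 by rewrite mxE => /negPf ->.
    have sum_h (f : 'I_d -> R) : \sum_j f j * h 0 j = f t * e.
      rewrite (bigD1 t) //= ht big1 ?addr0 // => j jt.
      by rewrite hj // mulr0.
    pose k i := if i \in V x y t then 1 else e * dpow 1 (y 0 t - x i 0 t).
    have : \sum_j v 0 j * h 0 j <= \sum_i eta i `^ 1 * k i.
      apply: subgradient_slope_le vy _ => // i; rewrite /k.
      case: ifPn => [_|iV].
        exists (fun=> 1); split=> [|s s0]; first exact: cvg_cst.
        rewrite !powRr1 ?lp_ge0 // !lp1E mulr1 -sumrB.
        apply: (@le_trans _ _ (\sum_j s * `|h 0 j|)).
          apply: ler_sum => j _; rewrite lerBlDl.
          have -> : (y - x i + s *: h) 0 j = (y - x i) 0 j + s * h 0 j.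
            by rewrite !mxE.
          by apply: le_trans (ler_normD _ _) _; rewrite normrM (gtr0_norm s0).
        rewrite -mulr_sumr (bigD1 t) //= ht e1' big1 ?addr0 ?mulr1 // => j jt.
        by rewrite hj // normr0.
      have ne : (y - x i) 0 t != 0 by rewrite !mxE subr_eq0; move: iV; rewrite inE.
      have -> : e * dpow 1 (y 0 t - x i 0 t) =
          \sum_j lp_grad 1 1 (y - x i) j * h 0 j.
        by rewrite sum_h /lp_grad subrr powRr0 !mul1r mulrC !mxE.
      apply: slope_le_grad => // [|j].
        by apply: contra_neq ne => ->; rewrite mxE.
      have [->|jt] := eqVneq j t; first by left.
      by rewrite hj ?eqxx.
    rewrite sum_h (bigID (fun i => i \in V x y t)) /= => h1.
    have eV : \sum_(i | i \in V x y t) eta i `^ 1 * k i =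
        \sum_(i | i \in V x y t) eta i.
      by apply: eq_bigr => i iV; rewrite /k iV mulr1.
    have eN : \sum_(i | i \notin V x y t) eta i `^ 1 * k i =
        e * gradD x eta 1 1 y 0 t.
      rewrite gradD11 mulr_sumr; apply: eq_bigr => i iV.
      by rewrite /k (negPf iV) e1 mulrCA.
    by rewrite eV eN in h1; rewrite mulrBr lerBlDr mulrC.
  rewrite ler_norml -lerN2 opprK.
  have := dir 1 (normr1 _); have := dir (- 1); rewrite normrN1 => /(_ erefl).
  by rewrite mulN1r mul1r => -> ->.
rewrite !costE -sumrB.
have -> : \sum_i (eta i `^ 1 * lp 1 (z - x i) `^ 1 -
    eta i `^ 1 * lp 1 (y - x i) `^ 1) =
    \sum_t \sum_i eta i * (`|z 0 t - x i 0 t| - `|y 0 t - x i 0 t|).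
  rewrite exchange_big; apply: eq_bigr => i _ /=.
  rewrite -mulrBr e1 !powRr1 ?lp_ge0 // !lp1E -sumrB mulr_sumr.
  by apply: eq_bigr => t _; rewrite !mxE.
apply: ler_sum => t _; set w := z 0 t - y 0 t.
have -> : v 0 t * w = gradD x eta 1 1 y 0 t * w +
   (v 0 t - gradD x eta 1 1 y 0 t) * w by ring.
have h1 : (v 0 t - gradD x eta 1 1 y 0 t) * w <=
    \sum_(i | i \in V x y t) eta i * `|w|.
  rewrite -mulr_suml; apply: le_trans (ler_norm _) _.
  by rewrite normrM ler_wpM2r.
apply: (le_trans (lerD (lexx _) h1)).
rewrite gradD11 mulr_suml [leRHS](bigID (fun i => i \in V x y t)) /= [leLHS]addrC.
apply: lerD; apply: ler_sum => i.
  by rewrite inE => /eqP yt; rewrite ler_pM2l // yt subrr normr0 subr0 /w yt.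
move=> _; rewrite -mulrA ler_pM2l // lerBrDl.
have := normr_tangent (y 0 t - x i 0 t) (z 0 t - x i 0 t) le11.
rewrite !powRr1 // mul1r (_ : z 0 t - x i 0 t - _ = w) // /w.
by rewrite opprB addrA subrK.
Qed.

Lemma subdifferential_formulaE (p q : R) y : injective x ->
  1 <= p < 2 -> 1 <= q <= p ->
  subdifferential (cost x eta p q) y = subdifferential_formula x eta p q y.
Proof.
move=> x_inj /andP[p1 p2] /andP[q1 qp]; apply/seteqP.
have [p_gt1|p_le1] := ltP 1 p; last first.
  have pE : p = 1 by apply/eqP; rewrite eq_le p_le1 p1.
  have qE : q = 1 by apply/eqP; rewrite eq_le q1 -pE qp.
  subst p q; split=> v.
    move=> /cost11_subgradientP hv; constructor 1; split=> //.
    exists (v - gradD x eta 1 1 y); last by rewrite addrC subrK.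
    move=> t; apply: le_trans (hv t); rewrite le_eqVlt; apply/orP; left.
    apply/eqP; congr (`| _ |); rewrite [LHS]mxE; congr (_ + _).
    by rewrite [LHS]mxE.
  case=> [[_ _ [u hu ->]]|[_]|[_]|[/andP[]]]; rewrite ?ltxx //.
  apply/cost11_subgradientP => t; rewrite [X in `|X - _|]mxE.
  by rewrite [X in `|X|]addrC addKr.
have p12 : 1 < p < 2 by rewrite p_gt1.
have yp i t : y 0 t = x i 0 t -> 1 < p by [].
have [q_gt1|q_le1] := ltP 1 q.
  have yq i : y = x i -> 1 < q by [].
  split=> v.
    move/(subgradient_unique eta_gt0 p1 q1 yq yp) => vE.
    by constructor 4; split=> //; rewrite q_gt1.
  case=> [[pE]|[qE]|[qE]|[_ _ ->]]; last exact: gradD_subgradient.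
  - by move: p_gt1; rewrite pE ltxx.
  - by move: q_gt1; rewrite qE ltxx.
  - by move: q_gt1; rewrite qE ltxx.
have qE : q = 1 by apply/eqP; rewrite eq_le q1 q_le1.
subst q.
have [[l yl]|ndata] := pselect (exists l, y = x l).
  split=> v.
    rewrite yl => /(data_point_subgradientP _ _ x_inj p_gt1)[b b1 vE].
    constructor 3; split=> //; exists l => //; exists b => //.
    by move: b1; rewrite lp.unlock.
  case=> [[pE]|[_ _ ndata]|[_ _ [l' -> [b b1 ->]]]|[/andP[]]].
  - by move: p_gt1; rewrite pE ltxx.
  - by have := ndata l; rewrite yl.
  - apply/data_point_subgradientP => //; exists b => //.
    by rewrite lp.unlock.
  - by rewrite ltxx.
have yq i : y = x i -> (1 : R) < 1 by move=> yi; case: ndata; exists i.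
split=> v.
  move/(subgradient_unique eta_gt0 p1 q1 yq yp) => vE.
  by constructor 2; split=> // i yi; case: ndata; exists i.
case=> [[pE]|[_ _ _ ->]|[_ _ [l yl]]|[/andP[]]].
- by move: p_gt1; rewrite pE ltxx.
- exact: gradD_subgradient.
- by case: ndata; exists l.
- by rewrite ltxx.
Qed.

End Formula.

(** * Cluster points of sequences *)

Lemma finite_set_nat_eventually (A : set nat) : finite_set A ->
  \forall k \near \oo, ~ A k.
Proof.
move=> /finite_seqP[s ->]; exists (\max_(j <- s) j).+1 => // k /= lt_k ks.
by move: lt_k; rewrite ltnNge; move/negP; apply; apply: leq_bigmax_seq.
Qed.

Lemma cvg_decrement (R : realType) (u : nat -> R) : cvg (u @ \oo) ->
  u k - u k.+1 @[k --> \oo] --> (0 : R).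
Proof.
move=> /cvg_ex[l ul]; rewrite -(subrr l); apply: cvgB => //.
by rewrite (cvg_shiftS u).
Qed.

Section ClusterPoints.
Variables (R : realType) (T : topologicalType).
Implicit Types (u : nat -> T) (c : T).

Lemma cluster_frequently u c (P : nat -> Prop) (U : set T) :
  cluster (u @ \oo) c -> (\forall k \near \oo, P k) -> nbhs c U ->
  exists2 k, P k & U (u k).
Proof.
move=> cu [N _ NP] cU.
have [|_ [[k Nk <-] Uuk]] := cu (u @` [set k | (N <= k)%N]) U _ cU.
  by exists N => // k Nk; exists k.
by exists k => //; exact: NP.
Qed.

Lemma cluster_cvg_eq u c (f : T -> R) (l : R) :
  cluster (u @ \oo) c -> f z @[z --> nbhs c] --> f c ->
  f (u k) @[k --> \oo] --> l -> f c = l.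
Proof.
move=> cu fc ful; apply/eqP; rewrite -subr_eq0 -normr_le0 leNgt; apply/negP => e0.
have e20 : 0 < `|f c - l| / 2 by rewrite divr_gt0.
have [k lk ck] := cluster_frequently cu (cvgr_dist_lt _ _ ful _ e20) (cvgr_dist_lt _ _ fc _ e20).
have := ler_normD (f c - f (u k)) (f (u k) - l).
by rewrite addrA subrK => /= h; rewrite distrC in lk; lra.
Qed.

(** A real sequence with vanishing steps that keeps returning below and above a
    keeps passing close to a. *)
Lemma frequently_near_value u c1 c2 (f : T -> R) (a : R) :
  cluster (u @ \oo) c1 -> cluster (u @ \oo) c2 ->
  f z @[z --> nbhs c1] --> f c1 -> f z @[z --> nbhs c2] --> f c2 ->
  f c1 < a < f c2 ->
  (forall e, 0 < e -> \forall k \near \oo, `|f (u k.+1) - f (u k)| < e) ->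
  forall e, 0 < e -> forall N, exists2 k, (N <= k)%N & `|f (u k) - a| < e.
Proof.
move=> cu1 cu2 f1 f2 /andP[ca1 ca2] steps e e0 N.
have [N1 _ N1P] := steps e e0.
have eN : \forall k \near \oo, (maxn N N1 <= k)%N by exists (maxn N N1).
have [k1 Nk1 k1a] := cluster_frequently cu1 eN (cvgr_lt _ f1 _ ca1).
have ek1 : \forall k \near \oo, (k1 <= k)%N by exists k1.
have [k2 k12 k2a] := cluster_frequently cu2 ek1 (cvgr_gt _ f2 _ ca2).
have exk : exists k, (k1 <= k)%N && (a < f (u k)) by exists k2; rewrite k12.
(* The first index after k1 with a value above a: the step into it crosses a. *)
case: (ex_minnP exk) => k /andP[k1k ka kmin].
have k1ltk : (k1 < k)%N.
  rewrite ltn_neqAle k1k andbT; apply/eqP => kE; move: ka k1a.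
  by rewrite kE /= => h1 h2; move: (lt_trans h1 h2); rewrite ltxx.
case: k k1k ka kmin k1ltk => // k k1k ka kmin k1ltk.
have fka : f (u k) <= a.
  rewrite leNgt; apply/negP => ak; have := kmin k; rewrite -ltnS k1ltk ak.
  by rewrite ltnn => /(_ isT).
move: Nk1; rewrite geq_max => /andP[NN1 N1N1].
have Nk : (N <= k)%N by rewrite (leq_trans NN1).
exists k => //; have := N1P k (leq_trans N1N1 k1ltk) => /=.
rewrite distrC [X in _ -> X < _]ler0_norm ?subr_le0 // distrC => h.
by apply: le_lt_trans h; apply: le_trans (ler_norm _); lra.
Qed.

End ClusterPoints.

Section Box.
Variables (R : realType) (d : nat).

Definition box (a : 'rV[R]_d) (r : R) : set 'rV[R]_d :=
  [set v | forall t, `[a 0 t - r, a 0 t + r]%classic (v 0 t)].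

Lemma box_compact a r : compact (box a r).
Proof.
apply: (@rV_compact _ _ (fun t => `[a 0 t - r, a 0 t + r]%classic)) => t.
exact: segment_compact.
Qed.

Lemma boxP a r (v : 'rV[R]_d) : box a r v <-> forall t, `|v 0 t - a 0 t| <= r.
Proof.
by split=> h t; move: (h t); rewrite /= in_itv /= ler_distl.
Qed.

Lemma cvg_coord (c : 'rV[R]_d) t : (z : 'rV[R]_d) 0 t @[z --> nbhs c] --> c 0 t.
Proof. exact: coord_continuous. Qed.

Lemma box_nbhs (a : 'rV[R]_d) (r : R) (c : 'rV[R]_d) : (forall t, `|c 0 t - a 0 t| < r) -> nbhs c (box a r).
Proof.
move=> cr.
have : \forall z \near nbhs c, forall t : 'I_d, `|(z : 'rV[R]_d) 0 t - a 0 t| <= r.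
  apply: (@filter_forall _ _ (fun t (z : 'rV[R]_d) => `|z 0 t - a 0 t| <= r)
    (nbhs c) (nbhs_filter c)) => t.
  have ca : (z : 'rV[R]_d) 0 t - a 0 t @[z --> nbhs c] --> c 0 t - a 0 t.
    by apply: cvgB; [exact: cvg_coord | exact: cvg_cst].
  near=> z; apply: ltW; near: z; exact: cvgr_norm_lt _ ca _ (cr t).
by apply: filterS => z /boxP.
Unshelve. all: by end_near.
Qed.

End Box.

Section BoundedSequences.
Variables (R : realType) (d : nat) (y : nat -> 'rV[R]_d) (a : 'rV[R]_d) (r : R).
Hypothesis y_box : forall k t, `|y k 0 t - a 0 t| <= r.

Lemma cluster_coord_le c t : cluster (y @ \oo) c -> `|c 0 t - a 0 t| <= r.
Proof.
move=> cy; rewrite leNgt; apply/negP => rc.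
have ca : (z : 'rV[R]_d) 0 t - a 0 t @[z --> nbhs c] --> c 0 t - a 0 t.
  by apply: cvgB; [exact: cvg_coord | exact: cvg_cst].
have eT : \forall k \near \oo, (fun _ : nat => True) k by exists 0%N.
have [k _] := cluster_frequently cy eT (cvgr_norm_gt _ ca _ rc).
by rewrite /= ltNge y_box.
Qed.

Lemma bounded_cluster_exists : exists c, cluster (y @ \oo) c.
Proof.
have yb : (y @ \oo) (box a r) by exists 0%N => // k _; apply/boxP => t.
have [c [_ cy]] := box_compact (a := a) (r := r) _ yb.
by exists c.
Qed.

Lemma bounded_unique_cluster_cvg c : cluster (y @ \oo) c ->
  (forall c', cluster (y @ \oo) c' -> c' = c) -> y @ \oo --> c.
Proof.
move=> cy uniq_c; apply: (@compact_cluster_set1 _ _ _ (box a (r + 1))) => //.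
- exact: box_compact.
- apply: box_nbhs => t; apply: (le_lt_trans (cluster_coord_le t cy)); lra.
- exists 0%N => // k _; apply/boxP => t; have := y_box k t; lra.
- by apply/seteqP; split=> [c' /uniq_c|c' ->].
Qed.

End BoundedSequences.

(** The cluster values of a coordinate with vanishing steps form an interval: a
    subsequence along which the coordinate tends to b has a cluster point by
    compactness. *)
Lemma cluster_between (R : realType) (d : nat) (y : nat -> 'rV[R]_d)
    (a : 'rV[R]_d) (r : R) c1 c2 t b :
  (forall k t, `|y k 0 t - a 0 t| <= r) ->
  cluster (y @ \oo) c1 -> cluster (y @ \oo) c2 -> c1 0 t < b < c2 0 t ->
  (forall e, 0 < e -> \forall k \near \oo, `|y k.+1 0 t - y k 0 t| < e) ->
  exists2 c, cluster (y @ \oo) c & c 0 t = b.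
Proof.
move=> y_box cy1 cy2 cb steps.
have near_b := @frequently_near_value _ _ y c1 c2 (fun z => z 0 t) b cy1 cy2
  (@cvg_coord _ _ _ _) (@cvg_coord _ _ _ _) cb steps.
have hk n : exists k, (n <= k)%N /\ `|y k 0 t - b| < n.+1%:R^-1.
  have [|k nk kb] := near_b n.+1%:R^-1 _ n; first by rewrite invr_gt0.
  by exists k.
have [s sP] := choice hk.
have s_oo : s n @[n --> \oo] --> \oo.
  move=> A [N _ NA]; exists N => // n Nn; apply: NA => /=.
  by have [sn _] := sP n; exact: leq_trans Nn sn.
have yb : (y \o s) n 0 t @[n --> \oo] --> b.
  apply/cvgrPdist_lt => e e0; near=> n.
  have [_ h] := sP n; rewrite distrC; apply: (lt_trans h).
  by near: n; exact: near_infty_natSinv_lt (PosNum e0).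
have ys_box k j : `|(y \o s) k 0 j - a 0 j| <= r by exact: y_box.
have [c cys] := bounded_cluster_exists ys_box.
exists c; last exact: cluster_cvg_eq cys (@cvg_coord _ _ c t) yb.
by apply: cvg_cluster cys => A; exact: s_oo.
Unshelve. all: by end_near. Qed.

(** * The iteration *)

Section Iteration.
Variables (R : realType) (d m : nat) (x : 'I_m -> 'rV[R]_d) (eta : 'I_m -> R).
Variables (p q : R).
Hypothesis eta_gt0 : forall i, 0 < eta i.
Hypotheses (p_ge1 : 1 <= p) (p_lt2 : p < 2) (q_ge1 : 1 <= q) (q_le_p : q <= p).
Hypothesis x_noncollinear : ~ collinear x.
Implicit Types (z c : 'rV[R]_d) (i : 'I_m) (t : 'I_d).

Let p_gt0 : 0 < p. Proof. exact: lt_le_trans ltr01 p_ge1. Qed.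
Let q_gt0 : 0 < q. Proof. exact: lt_le_trans ltr01 q_ge1. Qed.
Let m_gt0 : (0 < m)%N. Proof. exact: noncollinear_card_gt0 x_noncollinear. Qed.

Notation C := (cost x eta p q).
Notation S := (singular_set x).
Notation T := (T_op x eta p q).
Notation G := (gradD x eta p q).

Lemma gradD0_minimum z : G z = 0 -> is_minimum_point C z.
Proof.
move=> Gz; apply/minimum_subdifferential0; rewrite -Gz.
exact: gradD_subgradient.
Qed.

Lemma T_fixed_gradD0 z : ~ S z -> T z = z -> G z = 0.
Proof.
move=> zS Tz; apply/rowP => t; rewrite [RHS]mxE; apply/eqP.
rewrite gradD_eq0 // ?Tz // => i; exact: nonsingular_coord.
Qed.

Lemma nonsingular_minimumP z : ~ S z -> is_minimum_point C z <-> T z = z.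
Proof.
move=> zS; split=> [/minimum_subdifferential0 z0|Tz]; last first.
  exact/gradD0_minimum/T_fixed_gradD0.
have G0 : 0 = G z.
  apply: subgradient_unique z0 => // [i zi|i t zt].
    by have := nonsingular_neq i x_noncollinear zS; rewrite zi subrr eqxx.
  by case: zS; exists i, t.
apply/rowP => t; apply/eqP; rewrite -(@gradD_eq0 _ _ _ x eta p q) //.
  by rewrite -G0 mxE.
by move=> i; exact: nonsingular_coord.
Qed.

Let cvg_sub c i t : (z - x i) 0 t @[z --> nbhs c] --> (c - x i) 0 t.
Proof.
rewrite !mxE; under eq_cvg do rewrite !mxE.
by apply: cvgD; [exact: cvg_coord | exact: cvg_cst].
Qed.

Lemma cvg_cost c : C z @[z --> nbhs c] --> C c.
Proof.
rewrite costE; under eq_cvg do rewrite costE.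
apply: cvg_sumr => i _; apply: cvgMl_tmp; apply: cvg_lp_powR => //.
by right.
Qed.

Lemma cvg_weight c i t : c 0 t != x i 0 t ->
  weight x eta p q z i t @[z --> nbhs c] --> weight x eta p q c i t.
Proof.
move=> ct; apply: cvgM.
  apply: cvgMl_tmp; apply: cvg_lp_powR => //; left.
  exact: coord_neq_sub ct.
apply: cvg_normr_powR; first by left; rewrite subr_eq0.
by apply: cvgB; [exact: cvg_coord | exact: cvg_cst].
Qed.

Lemma cvg_T_op c t : (forall i, c 0 t != x i 0 t) ->
  T z 0 t @[z --> nbhs c] --> T c 0 t.
Proof.
move=> ct; rewrite T_opE; under eq_cvg do rewrite T_opE.
apply: cvgM; last apply: cvgV.
- by apply: cvg_sumr => i _; apply: cvgMr_tmp; exact: cvg_weight.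
- by rewrite gt_eqF // sum_weight_gt0.
- by apply: cvg_sumr => i _; exact: cvg_weight.
Qed.

Lemma nonsingular_near c : ~ S c -> \forall z \near nbhs c, ~ S z.
Proof.
move=> cS.
have near_it : \forall z \near nbhs c, forall it : 'I_m * 'I_d,
    (z : 'rV[R]_d) 0 it.2 != x it.1 0 it.2.
  apply: (@filter_forall _ _ (fun it (z : 'rV[R]_d) => z 0 it.2 != x it.1 0 it.2)
    (nbhs c) (nbhs_filter c)) => -[i t] /=.
  have cxt : (z : 'rV[R]_d) 0 t - x i 0 t @[z --> nbhs c] --> c 0 t - x i 0 t.
    by apply: cvgB; [exact: cvg_coord | exact: cvg_cst].
  have ne0 : 0 < `|c 0 t - x i 0 t|.
    by rewrite normr_gt0 subr_eq0 nonsingular_coord.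
  near=> z; rewrite -subr_eq0 -normr_gt0; near: z.
  exact: cvgr_norm_gt _ cxt _ ne0.
apply: filterS near_it => z zP [i [t zt]].
by have := zP (i, t); rewrite /= zt eqxx.
Unshelve. all: by end_near. Qed.

Variables (rho : R) (y : nat -> 'rV[R]_d).
Hypothesis y_iter : qPpNWAWS x eta p q rho y.

Lemma minimum_iterate_constant k : is_minimum_point C (y k) ->
  forall j, (k <= j)%N -> y j = y k.
Proof.
move=> kmin; elim=> [|j IH]; first by rewrite leqn0 => /eqP ->.
rewrite leq_eqVlt => /orP[/eqP <- //|]; rewrite ltnS => /IH yj.
by have [+ _ _] := y_iter j; rewrite yj; apply.
Qed.

Lemma cost_iterate_le k : C (y k.+1) <= C (y k).
Proof.
have [stop nonsing sing] := y_iter k.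
have [kmin|knmin] := pselect (is_minimum_point C (y k)).
  by rewrite stop.
have [kS|kS] := pselect (S (y k)); last first.
  by rewrite (nonsing knmin kS); apply: cost_T_op.
by have [w [lt_w _ ->]] := sing knmin kS; exact: ltW.
Qed.

Lemma cost_iterate_nonincreasing : {homo (fun k => C (y k)) : i j / (i <= j)%N >-> j <= i}.
Proof. by apply/nonincreasing_seqP => k; exact: cost_iterate_le. Qed.

Lemma cost_iterate_cvg : cvg ((fun k => C (y k)) @ \oo).
Proof.
apply: nonincreasing_is_cvgn; first exact: cost_iterate_nonincreasing.
by exists 0 => _ [k _ <-]; exact: cost_ge0.
Qed.

Lemma cost_decrease_cvg0 : C (y k) - C (y k.+1) @[k --> \oo] --> (0 : R).
Proof.
exact: (@cvg_decrement _ (fun k => C (y k)) cost_iterate_cvg).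
Qed.

Let i0 := Ordinal m_gt0.

Lemma iterate_bounded : exists r, forall k t, `|y k 0 t - x i0 0 t| <= r.
Proof.
have [D D0 DP] := level_bound x p eta_gt0 q_ge1 (C (y 0%N)).
exists D => k t; apply: le_trans (DP (y k) _ i0).
  by have := lp_coord (y k - x i0) t p_gt0; rewrite !mxE.
exact: cost_iterate_nonincreasing.
Qed.

Hypothesis no_min : forall k, ~ is_minimum_point C (y k).

(** The squared steps are dominated by the decrements of the convergent cost
    values. *)
Lemma T_op_iterate_near e : 0 < e -> \forall k \near \oo,
  ~ S (y k) -> forall t, `|T (y k) 0 t - y k 0 t| < e.
Proof.
move=> e0; have [kappa k0 kP] := level_descent eta_gt0 p_ge1 q_ge1 (C (y 0%N))
  p_lt2 q_le_p x_noncollinear.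
have ke0 : 0 < kappa * e ^+ 2 by rewrite mulr_gt0 // exprn_gt0.
have [N _ NP] := cvgr0_norm_lt _ cost_decrease_cvg0 _ ke0.
exists N => // k Nk kS t; rewrite ltNge; apply/negP => eT.
have := NP k Nk; rewrite /= ltNge => /negP; apply.
apply: le_trans (ler_norm _).
have [_ + _] := y_iter k => -> //.
apply: le_trans (kP (y k) _ kS t); last exact: cost_iterate_nonincreasing.
rewrite ler_pM2l // -(real_normK (num_real (T _ _ _ - _))).
by rewrite lerXn2r // nnegrE ltW.
Qed.

(** Otherwise (T z)_t - z_t would stay away from 0 near c, by continuity of
    that coordinate alone, while the steps of the iterates close to c tend to
    0. *)
Lemma cluster_T_op_fixed c t (U : set 'rV[R]_d) : cluster (y @ \oo) c ->
  nbhs c U -> (\forall k \near \oo, U (y k) -> ~ S (y k)) ->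
  (forall i, c 0 t != x i 0 t) -> T c 0 t = c 0 t.
Proof.
move=> cy cU US ct; apply/eqP; rewrite -subr_eq0 -normr_le0 leNgt.
apply/negP => e0.
have cT : T z 0 t - z 0 t @[z --> nbhs c] --> T c 0 t - c 0 t.
  by apply: cvgB; [exact: cvg_T_op | exact: cvg_coord].
have e20 : 0 < `|T c 0 t - c 0 t| / 2 by rewrite divr_gt0.
have e2 : `|T c 0 t - c 0 t| / 2 < `|T c 0 t - c 0 t|.
  by rewrite ltr_pdivrMr // ltr_pMr // ltr1n.
have [k [Uk near_k] [Uyk far_k]] := cluster_frequently cy
  (filterI US (T_op_iterate_near e20)) (filterI cU (cvgr_norm_gt _ cT _ e2)).
by have := near_k (Uk Uyk) t; move/(lt_trans far_k); rewrite ltxx.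
Qed.

Lemma nonsingular_cluster_minimum c : cluster (y @ \oo) c -> ~ S c ->
  G c = 0.
Proof.
move=> cy cS; apply: T_fixed_gradD0 => //; apply/rowP => t.
apply: (cluster_T_op_fixed cy (nonsingular_near cS)) => [|i].
  by exists 0%N.
exact: nonsingular_coord.
Qed.

Hypothesis p_gt1 : 1 < p.

(** By strictness, C c < C z for all z <> c. *)
Lemma gradD0_unique_minimum c z : G c = 0 -> is_minimum_point C z -> c = z.
Proof.
move=> Gc zmin; apply/eqP/negPn/negP => cz.
have := cost_tangent_strict eta_gt0 p_ge1 q_ge1 x_noncollinear p_gt1 cz.
rewrite Gc big1 => [|t _]; last by rewrite mxE mul0r.
by rewrite subr_gt0 ltNge zmin.
Qed.

(** All cluster points have the same cost, the limit of the cost values, so they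
    are all minimizers. *)
Lemma nonsingular_cluster_cvg c : cluster (y @ \oo) c -> ~ S c ->
  y @ \oo --> c.
Proof.
move=> cy cS; have Gc := nonsingular_cluster_minimum cy cS.
have [r yr] := iterate_bounded.
apply: (bounded_unique_cluster_cvg yr cy) => c' cy'.
have /cvg_ex[l Cl] := cost_iterate_cvg.
have Ccl := cluster_cvg_eq cy (@cvg_cost c) Cl.
have Ccl' := cluster_cvg_eq cy' (@cvg_cost c') Cl.
apply/esym/(gradD0_unique_minimum Gc) => z.
by rewrite Ccl' -Ccl; exact: gradD0_minimum.
Qed.

Hypothesis finitely_singular : finite_set [set k | S (y k)].

Let eventually_nonsingular : \forall k \near \oo, ~ S (y k).
Proof. exact: finite_set_nat_eventually finitely_singular. Qed.

(** Which data point, if any, each coordinate of z agrees with: a finite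
    invariant separating the cluster points. *)
Definition coord_code (z : 'rV[R]_d) : {ffun 'I_d -> option 'I_m} :=
  [ffun t => [pick i | z 0 t == x i 0 t]].

(** Where c and c' differ both gradients vanish, so the strict tangent
    inequalities at c and at c' would give C c < C c' and C c' < C c. *)
Lemma cluster_coord_code_inj c c' :
  cluster (y @ \oo) c -> cluster (y @ \oo) c' ->
  coord_code c = coord_code c' -> c = c'.
Proof.
move=> cy cy' code_eq.
have coordP t : c 0 t = c' 0 t \/ (G c 0 t = 0 /\ G c' 0 t = 0).
  have := congr1 (fun f : {ffun 'I_d -> option 'I_m} => f t) code_eq.
  rewrite !ffunE; case: pickP => [i /eqP ci|ci]; case: pickP => [j /eqP cj|cj] //.
    by case=> ij; left; rewrite ci ij.
  have fixG z : cluster (y @ \oo) z -> (fun i => z 0 t == x i 0 t) =1 xpred0 ->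
      G z 0 t = 0.
    move=> zy zi; have zt i : z 0 t != x i 0 t by rewrite zi.
    apply/eqP; rewrite gradD_eq0 //; apply/eqP.
    apply: (cluster_T_op_fixed zy filterT) => //.
    by apply: filterS eventually_nonsingular.
  by right; split; apply: fixG.
apply/eqP/negPn/negP => cc'.
have lt_C (a b : 'rV[R]_d) : a != b -> (forall t, a 0 t = b 0 t \/ G a 0 t = 0) -> C a < C b.
  move=> ab abP.
  have := cost_tangent_strict eta_gt0 p_ge1 q_ge1 x_noncollinear p_gt1 ab.
  rewrite big1 => [|t _]; first by rewrite subr_gt0.
  have [abt|->] := abP t; last by rewrite mul0r.
  by rewrite !mxE abt subrr mulr0.
have h1 : C c < C c' by apply: lt_C => // t; have [->|[-> _]] := coordP t; [left|right].
have h2 : C c' < C c.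
  by apply: lt_C; [rewrite eq_sym | move=> t; have [->|[_ ->]] := coordP t; [left|right]].
by have := lt_trans h1 h2; rewrite ltxx.
Qed.

(** All values between c_t and c'_t would be cluster values of the coordinate;
    one more of them than there are codes contradicts the injectivity of the
    code. *)
Lemma cluster_coord_not_lt c c' t : cluster (y @ \oo) c -> cluster (y @ \oo) c' ->
  ~ c 0 t < c' 0 t.
Proof.
move=> cy cy' lt_cc'; have [r yr] := iterate_bounded.
pose n := #|{ffun 'I_d -> option 'I_m}|.
pose b (j : 'I_n.+1) := c 0 t + (j.+1%:R / n.+2%:R) * (c' 0 t - c 0 t).
have n20 : (0 : R) < n.+2%:R by rewrite ltr0n.
have gap0 : 0 < c' 0 t - c 0 t by rewrite subr_gt0.
have b_between j : c 0 t < b j < c' 0 t.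
  apply/andP; split; first by rewrite ltrDl mulr_gt0 ?divr_gt0 ?ltr0n.
  rewrite -ltrBrDl gtr_pMl // ltr_pdivrMr // mul1r ltr_nat.
  by rewrite ltnS ltn_ord.
have steps e : 0 < e -> \forall k \near \oo, `|y k.+1 0 t - y k 0 t| < e.
  move=> e0; near=> k.
  have kS : ~ S (y k) by near: k; exact: eventually_nonsingular.
  have [_ + _] := y_iter k => -> //.
  suff : forall t, `|T (y k) 0 t - y k 0 t| < e by apply.
  move: kS; near: k; exact: T_op_iterate_near e0.
have hb j : exists z, cluster (y @ \oo) z /\ z 0 t = b j.
  by have [z zy zb] := cluster_between yr cy cy' (b_between j) steps; exists z.
have [z zP] := choice hb.
have code_inj : injective (coord_code \o z).
  move=> j j' /(cluster_coord_code_inj (zP j).1 (zP j').1) zE.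
  have : b j = b j' by rewrite -(zP j).2 -(zP j').2 zE.
  move=> /addrI /(mulIf (lt0r_neq0 gap0)) /(mulIf _) h.
  have /eqP := h (invr_neq0 (lt0r_neq0 n20)).
  by rewrite eqr_nat eqSS => /eqP /val_inj.
by have := leq_card _ code_inj; rewrite card_ord ltnn.
Unshelve. all: by end_near. Qed.

Lemma finitely_singular_cvg : cvg (y @ \oo).
Proof.
have [r yr] := iterate_bounded; have [c cy] := bounded_cluster_exists yr.
apply/cvg_ex; exists c; apply: (bounded_unique_cluster_cvg yr cy) => c' cy'.
apply/rowP => t.
case: (ltgtP (c' 0 t) (c 0 t)) => // lt_cc'.
  by case: (cluster_coord_not_lt cy' cy lt_cc').
by case: (cluster_coord_not_lt cy cy' lt_cc').
Qed.

End Iteration.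

Theorem theorem11 (R : realType) (d m : nat) (x : 'I_m -> 'rV[R]_d)
  (eta : 'I_m -> R) (p q rho : R) (y : nat -> 'rV[R]_d)
  (x_distinct : injective x) (x_noncollinear : ~ collinear x)
  (eta_gt0 : forall i, 0 < eta i)
  (p_range : 1 <= p < 2) (q_range : 1 <= q <= p) (rho_range : 0 < rho < 1)
  (y_iter : qPpNWAWS x eta p q rho y) :
  let C := cost x eta p q in
  let S := singular_set x in
  let no_min := forall k, ~ is_minimum_point C (y k) in
  [/\ (* (1) *)
      forall k,
        [/\ is_minimum_point C (y k) -> forall j, (k <= j)%N -> y j = y k,
            ~ S (y k) ->
              (is_minimum_point C (y k) <-> T_op x eta p q (y k) = y k) &
            S (y k) ->
              subdifferential C (y k) = subdifferential_formula x eta p q (y k)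
              /\ (is_minimum_point C (y k) <-> subdifferential C (y k) 0)],
      (* (2) *)
      no_min -> cvg ((fun k => C (y k)) @ \oo),
      (* (3) *)
      no_min -> 1 < p -> finite_set [set k | S (y k)] -> cvg (y @ \oo) &
      (* (4) *)
      no_min -> 1 < p -> forall c, cluster (y @ \oo) c -> ~ S c ->
        unique (is_minimum_point C) c /\ y @ \oo --> c].
Proof.
move=> C S no_min.
have [p_ge1 p_lt2] := andP p_range; have [q_ge1 q_le_p] := andP q_range.
split=> [k|_|nomin p_gt1 finS|nomin p_gt1 c cy cS].
- split=> [|kS|_].
  + exact: minimum_iterate_constant y_iter k.
  + exact: nonsingular_minimumP.
  + split; first exact: subdifferential_formulaE.
    exact: minimum_subdifferential0.
- exact: cost_iterate_cvg y_iter.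
- exact: finitely_singular_cvg y_iter nomin p_gt1 finS.
- split; last exact: nonsingular_cluster_cvg y_iter nomin p_gt1 c cy cS.
  have Gc : gradD x eta p q c = 0.
    exact: nonsingular_cluster_minimum y_iter nomin c cy cS.
  split; first exact: gradD0_minimum.
  by move=> z; exact: gradD0_unique_minimum.
Qed.
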